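(* Let $T$ be a tree with at least two vertices and let $d(T):=\operatorname{dist}_T(\mathcal S(T),\mathcal C(T))$ be the distance between its adjacency spectral center $\mathcal S(T)$ and its characteristic set $\mathcal C(T)$. If $d(T)\ge2$, then $|V(T)|\ge 2d(T)+11$.
   Context: All graphs are finite, simple and undirected. For a tree $T$ with at least two vertices, $\lambda_1(T)\ge\lambda_2(T)\ge\cdots$ are the eigenvalues of its adjacency matrix $A(T)$ and $0=\mu_1(T)<\mu_2(T)\le\cdots$ those of its Laplacian $L(T)$. Adjacency spectral center: $\mathcal S(T)$ is (the vertex set of) the unique minimal subtree $Y$ of $T$ such that every connected component of $T-Y$ has adjacency spectral radius at most $\lambda_2(T)$. It is known that this is well defined and consists of either one vertex or the two endpoints of one edge. Characteristic set: let $f$ be a Fiedler vector of $T$, i.e. an eigenvector of $L(T)$ for $\mu_2(T)$. It is known that exactly one of the following happens: (1) some entry of $f$ is zero, and then there is a unique vertex $v$ with $f_v=0$ that is adjacent to a vertex $w$ with $f_w\ne0$; in this case $\mathcal C(T)=\{v\}$; (2) no entry of $f$ is zero, and then there is a unique edge $uv$ with $f_u>0>f_v$; in this case $\mathcal C(T)=\{u,v\}$ (a characteristic edge). The set $\mathcal C(T)$ does not depend on the choice of $f$. For nonempty $X,Y\subseteq V(T)$, $\operatorname{dist}_T(X,Y):=\min\{d_T(x,y):x\in X,y\in Y\}$, where $d_T$ is the graph distance. *)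

(* Defs.v *)
From mathcomp Require Import all_boot all_order all_algebra.
From mathcomp Require Import polyrcf.
From mathcomp Require Import reals.

Set Implicit Arguments.
Unset Strict Implicit.
Unset Printing Implicit Defensive.

Import Order.TTheory GRing.Theory Num.Theory.

Local Open Scope ring_scope.

Section Graphs.

Variables (V : finType) (e : rel V).

(* A tree on V with adjacency relation e: a simple graph that is connected and
   has no cycle. A list c represents a cycle when it has at least three
   distinct vertices, consecutive ones (cyclically) being adjacent. *)
Definition is_tree : Prop :=
  [/\ symmetric e, irreflexive e, forall x y, connect e x y
    & forall c : seq V, (2 < size c)%N -> ~~ ucycleb e c].

(* The length of a shortest walk from x to y. The search is bounded by #|V|,
   which is the default value when y is not reachable from x; actual distances
   are smaller than #|V|. *)
Definition gdist (x y : V) : nat :=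
  find (fun n => [exists p : n.-tuple V, path e x p && (last x p == y)])
       (iota 0 #|V|).

(* The default #|V| of the minima exceeds every distance of a connected graph,
   so it only matters when X or Y is empty. *)
Definition set_dist (X Y : {set V}) : nat :=
  \big[minn/#|V|]_(x in X) \big[minn/#|V|]_(y in Y) gdist x y.

Definition restrict_rel (A : {set V}) : rel V :=
  [rel x y | [&& x \in A, y \in A & e x y]].

Definition component_in (A : {set V}) (x : V) : {set V} :=
  [set y in A | connect (restrict_rel A) x y].

(* Nonempty vertex sets inducing a connected subgraph; when e is a tree, these
   are exactly the vertex sets of its subtrees. *)
Definition subtree (Y : {set V}) : bool :=
  (Y != set0) && [forall x in Y, forall y in Y, connect (restrict_rel Y) x y].

Definition induced (A : {set V}) : rel {x : V | x \in A} :=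
  [rel u v : {x : V | x \in A} | e (val u) (val v)].

End Graphs.

Arguments induced {V} e A.

Section Spectra.

Variable R : realType.

(* The real roots of the characteristic polynomial in nondecreasing order, each
   repeated according to its multiplicity. For a symmetric matrix these are all
   of its eigenvalues. *)
Definition spectrum (n : nat) (M : 'M[R]_n) : seq R :=
  flatten [seq nseq (mup a (char_poly M)) a | a <- rootsR (char_poly M)].

Definition spectral_radius (n : nat) (M : 'M[R]_n) : R :=
  \big[Num.max/0]_(a <- spectrum M) `|a|.

Section Matrices.

Variables (V : finType) (e : rel V).

Definition adjacency : 'M[R]_#|V| :=
  \matrix_(i, j) (e (enum_val i) (enum_val j))%:R.

Definition laplacian : 'M[R]_#|V| :=
  diag_mx (\row_i #|e (enum_val i)|%:R) - adjacency.

Definition lambda2 : R := (rev (spectrum adjacency))`_1.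

Definition mu2 : R := (spectrum laplacian)`_1.

(* Vectors indexed by V are row vectors; as the Laplacian is symmetric,
   multiplying on the left or on the right is the same. *)
Definition fiedler (f : 'rV[R]_#|V|) : Prop :=
  f *m laplacian = mu2 *: f /\ f != 0.

Definition entry (f : 'rV[R]_#|V|) (v : V) : R := f 0 (enum_rank v).

(* In either case the set consists of all the candidates; for a Fiedler vector
   of a tree there is exactly one such vertex, resp. one such edge. *)
Definition characteristic_set_of (f : 'rV[R]_#|V|) : {set V} :=
  if [exists v, entry f v == 0]
  then [set v | (entry f v == 0) && [exists w, e v w && (entry f w != 0)]]
  else \bigcup_(p : V * V | [&& e p.1 p.2, 0 < entry f p.1 & entry f p.2 < 0])
         [set p.1; p.2].

Definition is_characteristic_set (C : {set V}) : Prop :=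
  exists2 f, fiedler f & C = characteristic_set_of f.

End Matrices.

Definition center_condition (V : finType) (e : rel V) (Y : {set V}) : bool :=
  subtree e Y &&
  [forall x in ~: Y,
     spectral_radius (adjacency (induced e (component_in e (~: Y) x)))
       <= lambda2 e].

Definition is_spectral_center (V : finType) (e : rel V) (S : {set V}) : bool :=
  minset (center_condition e) S.

End Spectra.

Arguments is_characteristic_set R {V} e C.
Arguments is_spectral_center R {V} e S.

(* Main.v *)
Require Import Defs.
From mathcomp Require Import all_boot all_order all_algebra.
From mathcomp Require Import reals.
From mathcomp Require Import perm polyrcf complex.
From mathcomp Require Import zify ring lra.

(* For an edge zw let B(z, w) be the component of T - z containing w. Take a
   shortest walk v_0, ..., v_d from S to C.

   Laplacian side. Let mu be the algebraic connectivity. Some branch Y of T at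
   v_d avoiding v_(d-1) carries the positive part of (plus or minus) a Fiedler
   vector, so its Dirichlet eigenvalue is at most mu. Eliminating vertices from
   the leaves towards the root turns Dirichlet energies into the Riccati
   recursion k_1 = mu, k_(s+1) = mu + k_s / (1 - k_s) of a path. This recursion
   is superadditive, so paths are extremal and k_s >= 1 for some s <= |Y|. On the
   other hand, no function on the branch X at v_d containing v_(d-1) has Rayleigh
   quotient below mu: combined with the one on Y it would contradict the
   minimality of mu. A branch B(v_0, u) with p vertices provides, via a test
   function that is constant off u, the value mu + (p-1) mu / (1 - mu), which
   exceeds k_2 when p >= 3 and k_4 when p >= 5 (then mu < 1/17); running the
   recursion along the d edges of the walk gives |Y| >= d + 3, resp.
   |Y| >= d + 5.

   Adjacency side. The Rayleigh quotients on B(v_0, v_1) are at most lambda_2. If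
   they were smaller than lambda_2, uniformly, on all other branches at v_0, then
   an eigenvector for lambda_2 would have to vanish at v_0 and v_1, which it
   cannot. As a tree with k + 1 vertices has spectral radius at most sqrt k,
   lower bounds for the size of B(v_1, v_2) give lower bounds for p: first
   p >= 3, hence |Y| >= d + 3; then lambda_2 > sqrt 3, so p >= 5, hence
   |Y| >= d + 5. Finally |V| >= d + p + 1 + |Y|. *)

Set Implicit Arguments.
Unset Strict Implicit.
Unset Printing Implicit Defensive.

Import Order.TTheory GRing.Theory Num.Theory.

Local Open Scope ring_scope.

(** * Real symmetric matrices *)

Section RealSpectral.

Variable R : realType.

Lemma mulmx_tr_rV_ge0 n (v : 'rV[R]_n) : 0 <= (v *m v^T) 0 0.
Proof. by rewrite mxE sumr_ge0 // => i _; rewrite mxE -expr2 sqr_ge0. Qed.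

Lemma mulmx_tr_rV_eq0 n (v : 'rV[R]_n) : ((v *m v^T) 0 0 == 0) = (v == 0).
Proof.
apply/eqP/eqP => [|->]; last by rewrite mul0mx mxE.
rewrite mxE => /eqP; rewrite psumr_eq0 => [/allP h|i _]; last first.
  by rewrite mxE -expr2 sqr_ge0.
apply/rowP => i; have := h i (mem_index_enum _).
by rewrite !mxE -expr2 sqrf_eq0 => /eqP.
Qed.

(** Over the complex numbers an eigenvector [v] for some [z] exists. Evaluating [v M v^*] in two
    ways gives [z = z^*], so [z] is a real root of the characteristic polynomial and has a real
    eigenvector, which is then normalised. *)
Lemma symmetric_eigenvector n (M : 'M[R]_n.+1) : M^T = M ->
  exists (a : R) (v : 'rV[R]_n.+1), v *m M = a *: v /\ v *m v^T = 1%:M.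
Proof.
move=> symM; pose f := real_complex R.
have [z] := @eigenvalue_closed (complex R) n.+1 (map_mx f M) isT.
case/eigenvalueP => v vM vN0.
have sym : (map_mx f M)^T = map_mx f M by rewrite map_trmx symM.
have zreal : z^* = z.
  pose q := v *m (map_mx Num.conj v)^T.
  have qN0 : q 0 0 != 0.
    rewrite mxE psumr_eq0 => [|i _]; last by rewrite !mxE mul_conjC_ge0.
    apply: contra vN0 => /allP h; apply/eqP/rowP => i.
    have := h i (mem_index_enum _).
    by rewrite !mxE mul_conjC_eq0 => /eqP.
  have e1 : v *m map_mx f M *m (map_mx Num.conj v)^T = z *: q.
    by rewrite vM -scalemxAl.
  have e2 : v *m map_mx f M *m (map_mx Num.conj v)^T = z^* *: q.
    have cM : map_mx Num.conj (map_mx f M) = map_mx f M.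
      by apply/matrixP => i j; rewrite !mxE; apply/CrealP/complex_realP; exists (M i j).
    rewrite -mulmxA -{1}sym -trmx_mul -{1}cM -map_mxM vM map_mxZ.
    by rewrite linearZ /= -scalemxAr.
  have /matrixP/(_ 0 0) := etrans (esym e1) e2.
  by rewrite [LHS]mxE [RHS]mxE => /(mulIf qN0).
have [a za] : exists a : R, z = f a.
  by have /CrealP/complex_realP[a ->] := zreal; exists a.
have : root (char_poly (map_mx f M)) z.
  by rewrite -eigenvalue_root_char; apply/eigenvalueP; exists v.
rewrite -map_char_poly za fmorph_root -eigenvalue_root_char.
case/eigenvalueP => u uM uN0; exists a.
have uu : 0 < (u *m u^T) 0 0.
  by rewrite lt_def mulmx_tr_rV_ge0 mulmx_tr_rV_eq0 uN0.
exists ((Num.sqrt ((u *m u^T) 0 0))^-1 *: u); split.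
  by rewrite -scalemxAl uM scalerA mulrC -scalerA.
rewrite linearZ /= -scalemxAl -scalemxAr scalerA -invfM -expr2.
rewrite sqr_sqrtr ?ltW //; apply/matrixP => i j.
by rewrite !ord1 [LHS]mxE mulVf ?gt_eqF // mxE.
Qed.

(* Householder reflection exchanging [v] and the first basis vector. *)
Lemma householder n (v : 'rV[R]_n.+1) : v *m v^T = 1%:M ->
  exists H : 'M[R]_n.+1, [/\ H^T = H, H *m H = 1%:M & delta_mx 0 0 *m H = v].
Proof.
move=> vv; have [u uE] : exists u, u = v - delta_mx 0 0 by exists (v - delta_mx 0 0).
have [u0|uN0] := eqVneq u 0.
  exists 1%:M; split; rewrite ?trmx1 ?mulmx1 //.
  by apply/eqP; rewrite eq_sym -subr_eq0 -uE u0.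
have uu : u *m u^T = (2 - 2 * v 0 0)%:M.
  rewrite uE linearB /= mulmxBr !mulmxBl vv trmx_delta mul_delta_mx.
  rewrite -rowE; apply/matrixP => i j; rewrite !ord1 !mxE eqxx /=.
  rewrite (bigD1 0) //= big1 => [|k kN0]; first by rewrite !mxE /=; ring.
  by rewrite !mxE (negPf kN0) mulr0.
set c := 2 - 2 * v 0 0 in uu.
have cN0 : c != 0.
  by apply: contra uN0 => /eqP c0; rewrite -mulmx_tr_rV_eq0 uu c0 !mxE eqxx.
(* Reflection in the hyperplane orthogonal to [u]; [c] is the squared length of [u]. *)
pose H : 'M[R]_n.+1 := 1%:M - (2 / c) *: (u^T *m u).
have uuu : u^T *m u *m (u^T *m u) = c *: (u^T *m u).
  by rewrite mulmxA -(mulmxA u^T) uu mul_mx_scalar -scalemxAl.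
exists H; split.
- by rewrite /H linearB /= linearZ /= trmx_mul trmxK trmx1.
- rewrite {1}/H mulmxBl mul1mx /H mulmxBr mulmx1 -scalemxAl -scalemxAr uuu !scalerA.
  have -> : 2 / c * (2 / c) * c = 2 / c + 2 / c by field.
  by rewrite scalerDl; set w := _ *: _; rewrite opprB [w + w - w]addrK subrK.
rewrite /H mulmxBr mulmx1 -scalemxAr mulmxA.
have -> : delta_mx 0 0 *m u^T = (v 0 0 - 1)%:M :> 'M_1.
  by rewrite uE -rowE; apply/matrixP => i j; rewrite !ord1 !mxE eqxx.
rewrite mul_scalar_mx scalerA.
have -> : 2 / c * (v 0 0 - 1) = -1.
  by rewrite /c in cN0 *; field.
by rewrite scaleN1r opprK uE addrC subrK.
Qed.

(** Induction on the size. Conjugation by the reflection that moves the first basis vector to a unit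
    eigenvector makes the first row, hence by symmetry the first column, vanish off the diagonal;
    the remaining block is symmetric again. *)
Theorem symmetric_diagonalization n (M : 'M[R]_n) : M^T = M ->
  exists (P : 'M[R]_n) (d : 'rV[R]_n),
    P *m P^T = 1%:M /\ M = P^T *m diag_mx d *m P.
Proof.
elim: n M => [|n IH] M symM.
  by exists 1%:M, 0; split; apply/matrixP => [[]].
have [a [v [vM vv]]] := symmetric_eigenvector symM.
have [H [symH HH eH]] := householder vv.
pose N : 'M[R]_(1 + n) := H *m M *m H.
have symN : N^T = N by rewrite /N !trmx_mul symH symM mulmxA.
have rowN : delta_mx 0 0 *m N = a *: delta_mx 0 0 :> 'rV_n.+1.
  by rewrite /N !mulmxA eH vM -eH -scalemxAl -mulmxA HH mulmx1.
have N0 (i j : 'I_(1 + n)) : val i = 0%N -> N i j = a * (val j == 0%N)%:R.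
  move=> i0; have -> : i = (0 : 'I_n.+1) by apply: val_inj.
  by move/rowP: rowN => /(_ j); rewrite -rowE !mxE eqxx.
have urN : ursubmx N = 0.
  apply/matrixP => i j; rewrite ursubmxEsub [LHS]mxE N0 /=; last by rewrite ord1.
  by rewrite [RHS]mxE mulr0.
have ulN : ulsubmx N = a%:M.
  apply/matrixP => i j; rewrite ulsubmxEsub [LHS]mxE N0 /=; last by rewrite ord1.
  by rewrite !ord1 [RHS]mxE mulr1.
have dlN : dlsubmx N = 0.
  by rewrite -[LHS]trmxK trmx_dlsub symN urN trmx0.
have [|P' [d' [PP' NP]]] := IH (drsubmx N); first by rewrite trmx_drsub symN.
pose P0 : 'M[R]_(1 + n) := block_mx 1%:M 0 0 P'.
pose D : 'rV[R]_(1 + n) := row_mx a%:M d'.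
have P0P0 : P0 *m P0^T = 1%:M.
  rewrite /P0 tr_block_mx mulmx_block !trmx0 trmx1 !mulmx0 !mul0mx !addr0 add0r.
  by rewrite mulmx1 PP' -scalar_mx_block.
have P0N : P0^T *m diag_mx D *m P0 = N.
  rewrite -[N]submxK urN ulN dlN NP /D diag_mx_row /P0 tr_block_mx !mulmx_block.
  rewrite !trmx0 trmx1 !mulmx0 !mul0mx !addr0 !add0r !mul1mx !mulmx1 mul0mx.
  congr (block_mx _ _ _ _).
  by apply/matrixP => i j; rewrite !ord1 !mxE eqxx.
exists (P0 *m H), D; split.
  by rewrite trmx_mul symH mulmxA -(mulmxA P0) HH mulmx1.
have -> : M = H *m N *m H.
  by rewrite /N !mulmxA HH mul1mx -!mulmxA HH mulmx1.
by rewrite trmx_mul symH -!mulmxA; congr (H *m _); rewrite !mulmxA P0N.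
Qed.

Lemma char_poly_diagonalization n (P : 'M[R]_n) (d : 'rV[R]_n) :
  P *m P^T = 1%:M ->
  char_poly (P^T *m diag_mx d *m P) = \prod_i ('X - (d 0 i)%:P).
Proof.
move=> PP; have PP' : P^T *m P = 1%:M by apply: mulmx1C.
rewrite /char_poly /char_poly_mx !map_mxM /=.
set Q := map_mx polyC P; set Qt := map_mx polyC P^T.
have QQ : Qt *m Q = 1%:M by rewrite /Qt /Q -map_mxM PP' map_mx1.
have -> : 'X%:M - Qt *m map_mx polyC (diag_mx d) *m Q
        = Qt *m ('X%:M - map_mx polyC (diag_mx d)) *m Q.
  by rewrite mulmxBr mulmxBl mul_mx_scalar -scalemxAl QQ scalemx1.
rewrite !det_mulmx mulrAC -det_mulmx QQ det1 mul1r map_diag_mx.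
have -> : 'X%:M = diag_mx (const_mx 'X) :> 'M[{poly R}]_n by rewrite diag_const_mx.
rewrite -linearB /= det_diag; apply: eq_bigr => i _; by rewrite !mxE.
Qed.

Lemma count_flatten_nseq (m : R -> nat) (s : seq R) (a : R) : uniq s ->
  count_mem a (flatten [seq nseq (m x) x | x <- s]) = (if a \in s then m a else 0)%N.
Proof.
elim: s => //= x s IH /andP[xs us]; rewrite count_cat IH // count_nseq in_cons.
rewrite eq_sym /=; have [->|_] := eqVneq a x; last by rewrite mul0n.
by rewrite (negPf xs) mul1n addn0.
Qed.

Lemma sorted_flatten_nseq (m : R -> nat) (s : seq R) :
  sorted <=%R s -> sorted <=%R (flatten [seq nseq (m x) x | x <- s]).
Proof.
rewrite !(sorted_pairwise le_trans).
elim: s => //= x s IH /andP[xs ps]; rewrite pairwise_cat IH // andbT.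
apply/andP; split.
  apply/allrelP => y z; rewrite mem_nseq => /andP[_ /eqP->].
  case/flattenP => t /mapP[w ws ->]; rewrite mem_nseq => /andP[_ /eqP->].
  exact: (allP xs).
elim: (m x) => //= k ->; rewrite andbT; apply/allP => y.
by rewrite mem_nseq => /andP[_ /eqP->].
Qed.

Lemma spectrum_sorted n (M : 'M[R]_n) : sorted <=%R (spectrum M).
Proof. by apply: sorted_flatten_nseq; apply: sub_sorted (sorted_roots _ _ _) => x y /ltW. Qed.

(** On both sides the number of occurrences of [a] is its multiplicity as a root of the
    characteristic polynomial. *)
Lemma perm_spectrum n (P : 'M[R]_n) (d : 'rV[R]_n) : P *m P^T = 1%:M ->
  perm_eq (spectrum (P^T *m diag_mx d *m P)) [seq d 0 i | i <- enum 'I_n].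
Proof.
move=> PP; apply/allP => a _; rewrite /=; apply/eqP.
rewrite /spectrum count_flatten_nseq ?uniq_roots // char_poly_diagonalization //.
set p := \prod_i _; have pE : p = \prod_(y <- [seq d 0 i | i <- enum 'I_n]) ('X - y%:P).
  by rewrite big_map big_enum.
have pN0 : p != 0 by rewrite pE monic_neq0 ?monic_prod_XsubC.
rewrite -mu_prod_XsubC -pE; case: ifP => // /negbT ar; apply/esym/mupNroot.
apply: contra ar => pa; have := roots_on_rootsR pN0 a.
by rewrite inE /= pa => <-.
Qed.

End RealSpectral.

(** * Rayleigh quotients in an eigenbasis *)

Section Rayleigh.

Variable R : realType.

Lemma size_spectrum n (M : 'M[R]_n) : M^T = M -> size (spectrum M) = n.
Proof.
move=> /symmetric_diagonalization[P [d [PP ->]]].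
by rewrite (perm_size (perm_spectrum d PP)) size_map size_enum_ord.
Qed.

(** Permuting the rows of [P] puts the eigenvalues in the order of [spectrum], so that [lambda2] and
    [mu2] belong to known rows. *)
Lemma spectrum_diagonalization n (M : 'M[R]_n) : M^T = M ->
  exists P : 'M[R]_n, P *m P^T = 1%:M /\
    M = P^T *m diag_mx (\row_i (spectrum M)`_i) *m P.
Proof.
move=> symM; have sz := size_spectrum symM.
have [P [d [PP MP]]] := symmetric_diagonalization symM.
have := perm_spectrum d PP; rewrite -MP => perm_d.
have sz' : size (spectrum M) == n by rewrite sz.
have /tuple_permP[s sE] : perm_eq (Tuple sz') [tuple d 0 i | i < n].
  by rewrite (perm_trans perm_d) // enumT.
have dE (i : 'I_n) : (spectrum M)`_i = d 0 (s i).
  have -> : spectrum M = Tuple sz' by [].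
  rewrite sE (nth_map i) ?size_enum_ord // nth_ord_enum.
  by rewrite tnth_map tnth_ord_tuple.
exists (row_perm s P); split.
  apply/matrixP => i j; have /matrixP/(_ (s i) (s j)) := PP.
  rewrite !mxE (inj_eq perm_inj) => <-.
  by apply: eq_bigr => k _; rewrite !mxE.
rewrite {1}MP; apply/matrixP => x y; rewrite !mxE.
rewrite (reindex_inj (@perm_inj _ s)); apply: eq_bigr => i _.
rewrite !mul_mx_diag !mxE -dE.
by [].
Qed.

Lemma diagonal_formE n (P : 'M[R]_n) (d v : 'rV[R]_n) :
  (v *m (P^T *m diag_mx d *m P) *m v^T) 0 0
    = \sum_i d 0 i * (v *m P^T) 0 i ^+ 2.
Proof.
have -> : v *m (P^T *m diag_mx d *m P) *m v^T
        = (v *m P^T) *m diag_mx d *m (v *m P^T)^T.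
  by rewrite trmx_mul trmxK !mulmxA.
rewrite mxE; apply: eq_bigr => i _.
by rewrite mul_mx_diag !mxE; ring.
Qed.

Lemma orthogonal_normE n (P : 'M[R]_n) (v : 'rV[R]_n) : P *m P^T = 1%:M ->
  (v *m v^T) 0 0 = \sum_i (v *m P^T) 0 i ^+ 2.
Proof.
move=> PP; have PP' : P^T *m P = 1%:M by apply: mulmx1C.
have -> : v *m v^T = (v *m P^T) *m (v *m P^T)^T.
  by rewrite trmx_mul trmxK -!mulmxA (mulmxA P^T) PP' mul1mx.
by rewrite mxE; apply: eq_bigr => i _; rewrite [X in _ * X]mxE expr2.
Qed.

Lemma row_diagonalization n (P : 'M[R]_n) (d : 'rV[R]_n) i : P *m P^T = 1%:M ->
  row i P *m (P^T *m diag_mx d *m P) = d 0 i *: row i P.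
Proof.
move=> PP; rewrite -row_mul !mulmxA PP mul1mx mul_diag_mx.
by apply/rowP => j; rewrite !mxE.
Qed.

Lemma row_orthogonal n (P : 'M[R]_n) i j : P *m P^T = 1%:M ->
  (row i P *m (row j P)^T) 0 0 = (i == j)%:R.
Proof.
move=> /matrixP/(_ i j); rewrite !mxE => <-.
by apply: eq_bigr => k _; rewrite !mxE.
Qed.

Lemma rayleigh_le n (M : 'M[R]_n) (v : 'rV[R]_n) a : M^T = M ->
  (forall x, x \in spectrum M -> x <= a) ->
  (v *m M *m v^T) 0 0 <= a * (v *m v^T) 0 0.
Proof.
move=> symM ha; have [P [PP MP]] := spectrum_diagonalization symM.
rewrite {1}MP diagonal_formE (orthogonal_normE _ PP) mulr_sumr ler_sum // => i _.
by rewrite ler_wpM2r ?sqr_ge0 // mxE ha // mem_nth // size_spectrum.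
Qed.

Lemma rayleigh_le_spectral_radius n (M : 'M[R]_n) (v : 'rV[R]_n) : M^T = M ->
  (v *m M *m v^T) 0 0 <= spectral_radius M * (v *m v^T) 0 0.
Proof.
move=> symM; apply: rayleigh_le => // x xs.
by rewrite (le_trans (ler_norm x)) // /spectral_radius le_bigmax_seq.
Qed.

Lemma spectrum_le n (M : 'M[R]_n) i j : M^T = M -> (i <= j < n)%N ->
  (spectrum M)`_i <= (spectrum M)`_j.
Proof.
move=> symM /andP[ij jn]; apply: (sorted_leq_nth le_trans lexx) => //.
- exact: spectrum_sorted.
- by rewrite inE size_spectrum // (leq_ltn_trans ij).
- by rewrite inE size_spectrum.
Qed.

End Rayleigh.

(** * Adjacency and Laplacian acting on functions, and their second eigenvalues *)

Section GraphForms.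

Variables (R : realType) (V : finType) (e : rel V).
Hypothesis symE : symmetric e.

Implicit Types g h : V -> R.

Definition vec g : 'rV[R]_#|V| := \row_i g (enum_val i).

Definition neighbor_sum g x := \sum_(y | e x y) g y.

Definition laplace g x := \sum_(y | e x y) (g x - g y).

Lemma sum_enum_val (F : V -> R) : \sum_(i < #|V|) F (enum_val i) = \sum_x F x.
Proof. by rewrite [RHS]big_enum_val. Qed.

Lemma vec_entry (v : 'rV[R]_#|V|) : vec (entry v) = v.
Proof. by apply/rowP => i; rewrite mxE /entry enum_valK. Qed.

Lemma entry_vec g x : entry (vec g) x = g x.
Proof. by rewrite /entry mxE enum_rankK. Qed.

Lemma eq_vec g h : vec g = vec h -> g =1 h.
Proof. by move=> gh x; rewrite -entry_vec gh entry_vec. Qed.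

Lemma vecZ a g : a *: vec g = vec (fun x => a * g x).
Proof. by apply/rowP => i; rewrite !mxE. Qed.

Lemma vec_dot g h : (vec g *m (vec h)^T) 0 0 = \sum_x g x * h x.
Proof.
by rewrite mxE -sum_enum_val; apply: eq_bigr => i _; rewrite !mxE.
Qed.

Lemma vec_adjacency g : vec g *m adjacency R e = vec (neighbor_sum g).
Proof.
apply/rowP => i; rewrite !mxE /neighbor_sum.
rewrite [RHS]big_mkcond -sum_enum_val; apply: eq_bigr => j _.
by rewrite !mxE symE; case: (e _ _); rewrite ?mulr1 ?mulr0.
Qed.

Lemma laplaceE g x : laplace g x = #|e x|%:R * g x - neighbor_sum g x.
Proof. by rewrite /laplace sumrB sumr_const mulr_natl. Qed.

Lemma vec_laplacian g : vec g *m laplacian R e = vec (laplace g).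
Proof.
rewrite mulmxBr vec_adjacency mul_mx_diag.
by apply/rowP => i; rewrite !mxE laplaceE mulrC.
Qed.

Lemma adjacency_sym : (adjacency R e)^T = adjacency R e.
Proof. by apply/matrixP => i j; rewrite !mxE symE. Qed.

Lemma laplacian_sym : (laplacian R e)^T = laplacian R e.
Proof. by rewrite linearB /= tr_diag_mx adjacency_sym. Qed.

(** Every edge is counted in both directions, whence the factors 2 in the statements about
    [dirichlet]. *)
Definition dirichlet g := \sum_x \sum_(y | e x y) (g x - g y) ^+ 2.

Lemma dirichlet_ge0 g : 0 <= dirichlet g.
Proof. by apply: sumr_ge0 => x _; apply: sumr_ge0 => y _; apply: sqr_ge0. Qed.

Lemma dirichletE g : dirichlet g = 2 * \sum_x g x * laplace g x.
Proof.
have swap : \sum_x \sum_(y | e x y) g y * (g x - g y)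
          = - \sum_x g x * laplace g x.
  rewrite (exchange_big_dep xpredT) //= -sumrN; apply: eq_bigr => x _.
  rewrite mulr_sumr -sumrN; apply: eq_big => [y|y _]; first exact: symE.
  by rewrite -mulrN opprB.
rewrite mulr_natl mulr2n -[X in _ + X]opprK -swap -sumrB.
apply: eq_bigr => x _; rewrite mulr_sumr -sumrB; apply: eq_bigr => y _; ring.
Qed.

Lemma vec_surj (v : 'rV[R]_#|V|) : exists g, v = vec g.
Proof. by exists (entry v); rewrite vec_entry. Qed.

Lemma dirichlet_eq0 g : (forall x y, connect e x y) -> dirichlet g = 0 ->
  forall x y, g x = g y.
Proof.
move=> conn /eqP; rewrite psumr_eq0 => [/allP D0|x _]; last first.
  by apply: sumr_ge0 => y _; apply: sqr_ge0.
have step x y : e x y -> g x = g y.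
  move=> exy; have := D0 x (mem_index_enum _); rewrite /= psumr_eq0.
    move=> /allP/(_ y (mem_index_enum _)); rewrite exy /= sqrf_eq0 subr_eq0.
    by move/eqP.
  by move=> z _; apply: sqr_ge0.
move=> x y; have /connectP[p + ->] := conn x y.
by elim: p x => //= z p IH x /andP[/step-> /IH].
Qed.

Lemma fiedler_eigenfunction f : fiedler e f ->
  laplace (entry f) =1 (fun x => mu2 R e * entry f x) /\ exists x, entry f x != 0.
Proof.
case=> fL fN0; split.
  by apply: eq_vec; rewrite -vec_laplacian -vecZ vec_entry.
apply/existsP; apply: contraNT fN0 => /existsPn f0.
rewrite -[f]vec_entry; apply/eqP/rowP => i; rewrite !mxE.
by apply/eqP; rewrite -[_ == _]negbK f0.
Qed.

Hypothesis cardV : (1 < #|V|)%N.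

Let sizeA := size_spectrum adjacency_sym.

(** The spectrum is nondecreasing, so the last two rows of [P] belong to the largest eigenvalue [l]
    and to [lambda2]. *)
Lemma lambda2_eigenfunctions : exists (l : R) g0 g1,
  [/\ neighbor_sum g0 =1 (fun x => l * g0 x),
      neighbor_sum g1 =1 (fun x => lambda2 R e * g1 x),
      (\sum_x g0 x ^+ 2 = 1) /\ (\sum_x g1 x ^+ 2 = 1),
      \sum_x g0 x * g1 x = 0
    & forall h, \sum_x h x * neighbor_sum h x <= l * \sum_x h x ^+ 2].
Proof.
have [P [PP AP]] := spectrum_diagonalization adjacency_sym.
set s := spectrum _ in AP.
have i0P : (#|V|.-1 < #|V|)%N by lia.
have i1P : (#|V|.-2 < #|V|)%N by lia.
have ne : (#|V|.-1 != #|V|.-2)%N by case: #|V| cardV => [|[]] // n _; rewrite /= gtn_eqF.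
pose i0 := Ordinal i0P; pose i1 := Ordinal i1P.
have i01 : i0 != i1 by rewrite -(inj_eq val_inj).
have [g0 g0E] := vec_surj (row i0 P); have [g1 g1E] := vec_surj (row i1 P).
have l2E : lambda2 R e = s`_i1.
  by rewrite /lambda2 nth_rev sizeA ?subn2.
exists s`_i0, g0, g1; split.
- apply: eq_vec; rewrite -vec_adjacency AP -g0E row_diagonalization // mxE.
  by rewrite g0E vecZ.
- apply: eq_vec; rewrite -vec_adjacency AP -g1E row_diagonalization // mxE.
  by rewrite g1E vecZ l2E.
- have := row_orthogonal i0 i0 PP; have := row_orthogonal i1 i1 PP.
  by rewrite !eqxx g0E g1E !vec_dot.
- have := row_orthogonal i0 i1 PP; rewrite g0E g1E vec_dot => ->.
  by rewrite (negPf i01).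
move=> h; have : (vec h *m adjacency R e *m (vec h)^T) 0 0 <=
    s`_i0 * (vec h *m (vec h)^T) 0 0.
  apply: rayleigh_le adjacency_sym _ => x xs; case/(nthP 0): xs => i; rewrite sizeA => ilt <-.
  apply: spectrum_le; first exact: adjacency_sym.
  by rewrite i0P -ltnS prednK ?ilt // (leq_ltn_trans _ ilt).
rewrite vec_adjacency !vec_dot.
have -> : \sum_x neighbor_sum h x * h x = \sum_x h x * neighbor_sum h x.
  by apply: eq_bigr => x _; rewrite mulrC.
by have -> : \sum_x h x ^+ 2 = \sum_x h x * h x by apply: eq_bigr => x _; rewrite expr2.
Qed.

Lemma mu2_spec : (forall x y, connect e x y) -> 0 < mu2 R e /\
  forall g, \sum_x g x = 0 -> 2 * mu2 R e * \sum_x g x ^+ 2 <= dirichlet g.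
Proof.
move=> conn; have [P [PP LP]] := spectrum_diagonalization laplacian_sym.
set s := spectrum _ in LP; set d := \row_i _ in LP.
have i0P : (0 < #|V|)%N by lia.
pose i0 := Ordinal i0P; pose i1 := Ordinal cardV.
have le_s (i j : 'I_#|V|) : (i <= j)%N -> s`_i <= s`_j.
  by move=> ij; apply: spectrum_le; [exact: laplacian_sym|rewrite ij /=].
have formE g : dirichlet g = 2 * \sum_(i < #|V|) s`_i * (vec g *m P^T) 0 i ^+ 2.
  rewrite dirichletE; congr (2 * _).
  have -> : \sum_x g x * laplace g x = \sum_x laplace g x * g x.
    by apply: eq_bigr => x _; rewrite mulrC.
  rewrite -vec_dot -vec_laplacian LP diagonal_formE.
  by apply: eq_bigr => i _; rewrite mxE.
have normE g : \sum_x g x ^+ 2 = \sum_i (vec g *m P^T) 0 i ^+ 2.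
  rewrite -orthogonal_normE // vec_dot.
  by apply: eq_bigr => x _; rewrite expr2.
have coordE g i : (vec g *m P^T) 0 i = (vec g *m (row i P)^T) 0 0.
  by rewrite !mxE; apply: eq_bigr => k _; rewrite !mxE.
(* Otherwise the first two rows of [P] would have Dirichlet energy zero, hence be constant by
   connectivity; but nonzero constant vectors are not orthogonal. *)
have mu_gt0 : 0 < mu2 R e.
  rewrite ltNge; apply/negP => mu_le0.
  have const (i : 'I_#|V|) : (i <= i1)%N -> exists c, row i P = vec (fun=> c).
    move=> ii1; have [g gE] := vec_surj (row i P).
    have g0 : dirichlet g = 0.
      apply/eqP; rewrite eq_le dirichlet_ge0 andbT formE.
      rewrite (bigD1 i) //= big1 ?addr0 => [|j ji].
        rewrite pmulr_rle0 // coordE gE -gE row_orthogonal // eqxx expr1n mulr1.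
        by rewrite (le_trans (le_s _ _ ii1)).
      by rewrite coordE -gE row_orthogonal // eq_sym (negPf ji) expr0n mulr0.
    exists (g (enum_val i)); rewrite gE; apply/rowP => j; rewrite !mxE.
    exact: dirichlet_eq0.
  have [c0 c0E] := const i0 isT; have [c1 c1E] := const i1 (leqnn _).
  have := row_orthogonal i0 i1 PP; have := row_orthogonal i0 i0 PP.
  have := row_orthogonal i1 i1 PP.
  rewrite c0E c1E !vec_dot !sumr_const !eqxx /= => h1 h0.
  move/eqP; rewrite mulrn_eq0 mulf_eq0; case/or3P => [|/eqP c|/eqP c].
  - by move/eqP=> V0; move: cardV; rewrite [#|V|]V0.
  - by move/eqP: h0; rewrite c mul0r mul0rn eq_sym oner_eq0.
  - by move/eqP: h1; rewrite c mul0r mul0rn eq_sym oner_eq0.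
split => // g sg0.
have pos (i : 'I_#|V|) : i != i0 -> mu2 R e <= s`_i.
  move=> ii0; have -> : mu2 R e = s`_i1 by [].
  by apply: le_s; rewrite /= lt0n -(inj_eq val_inj) in ii0 *.
(* The Laplacian kills the constant function 1, so its coordinates [t] vanish except at [i0]. A
   function with zero sum is orthogonal to it and therefore has coordinate zero at [i0]. *)
pose t := vec (fun=> 1) *m P^T.
have tE i : i != i0 -> t 0 i = 0.
  move=> ii0; have lapl0 : vec (fun=> 1) *m laplacian R e = 0.
    rewrite vec_laplacian; apply/rowP => j; rewrite !mxE /laplace big1 // => y _.
    by rewrite subrr.
  have : (vec (fun=> 1) *m laplacian R e *m P^T) 0 i = 0.
    by rewrite lapl0 mul0mx mxE.
  rewrite LP !mulmxA -(mulmxA _ P) PP mulmx1 mul_mx_diag -/t [_ 0 i]mxE mxE => /eqP.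
  rewrite mulf_eq0 => /orP[/eqP //|/eqP si0].
  move: si0; rewrite mxE => si0.
  by have := lt_le_trans mu_gt0 (pos i ii0); rewrite si0 ltxx.
have t0 : t 0 i0 != 0.
  apply/eqP => t00; have := normE (fun=> 1).
  rewrite [RHS]big1 => [|i _]; last first.
    by rewrite -/t; have [->|/tE->] := eqVneq i i0; rewrite ?t00 expr0n.
  under eq_bigr do rewrite expr1n.
  rewrite sumr_const => /eqP; rewrite pnatr_eq0 => /eqP V0.
  by move: cardV; rewrite V0.
have w0 : (vec g *m P^T) 0 i0 = 0.
  have : (vec g *m P^T *m t^T) 0 0 = 0.
    have PP' : P^T *m P = 1%:M by apply: mulmx1C.
    rewrite /t trmx_mul trmxK mulmxA -(mulmxA _ P^T) PP' mulmx1 vec_dot.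
    by under eq_bigr do rewrite mulr1.
  rewrite mxE (bigD1 i0) //= big1 ?addr0 => [|i /tE ti]; last first.
    by rewrite [X in _ * X]mxE ti mulr0.
  by rewrite [X in _ * X]mxE => /eqP; rewrite mulf_eq0 (negPf t0) orbF => /eqP.
rewrite formE normE -mulrA; apply: ler_wpM2l => //; rewrite mulr_sumr.
apply: ler_sum => i _; have [->|/pos mi] := eqVneq i i0.
  by rewrite w0 expr0n !mulr0.
by rewrite ler_wpM2r ?sqr_ge0.
Qed.

End GraphForms.

(** Translates the spectral radius of a component, whose matrix is indexed by a subtype, into a
    bound for functions on [V]. *)
Lemma induced_rayleigh (R : realType) (V : finType) (e : rel V) (A : {set V})
    (h : V -> R) : symmetric e ->
  \sum_(x in A) \sum_(y in A | e x y) h x * h y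
    <= spectral_radius (adjacency R (induced e A)) * \sum_(x in A) h x ^+ 2.
Proof.
move=> symE; have symI : symmetric (induced e A) by move=> u v; apply: symE.
have := rayleigh_le_spectral_radius (vec (h \o val)) (adjacency_sym R symI).
rewrite vec_adjacency // !vec_dot.
have -> : \sum_(x in A) h x ^+ 2 = \sum_(u : {x | x \in A}) (h \o val) u * (h \o val) u.
  by rewrite [LHS]big_sub; apply: eq_bigr => u _; rewrite expr2.
apply: le_trans; rewrite le_eqVlt; apply/orP; left; apply/eqP.
rewrite [LHS]big_sub; apply: eq_bigr => u _ /=.
rewrite mulrC mulr_sumr [LHS]big_sub_cond.
by apply: eq_bigr => v _.
Qed.

(** * Branches of a tree *)

Section Branches.

Variables (V : finType) (e : rel V).

(** This is B(z, w) of the overview. For an edge it is read as a rooted tree with root [w], hanging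
    from [z]. *)
Definition branch (z w : V) : {set V} :=
  [set x | connect (restrict_rel e (~: [set z])) w x].

Lemma restrict_setC1 z x y :
  restrict_rel e (~: [set z]) x y = [&& x != z, y != z & e x y].
Proof. by rewrite /restrict_rel /= !in_setC !in_set1. Qed.

Lemma branch_self z w : w \in branch z w.
Proof. by rewrite inE connect0. Qed.

Lemma branch_step z w x y : x \in branch z w -> e x y -> x != z -> y != z ->
  y \in branch z w.
Proof.
rewrite !inE => wx exy xz yz; apply: connect_trans wx (connect1 _).
by rewrite restrict_setC1 xz yz.
Qed.

Lemma sub_branch z w (A : {pred V}) : w \in A ->
  (forall x y, x \in A -> e x y -> x != z -> y != z -> y \in A) ->
  {subset branch z w <= A}.
Proof.
move=> wA step x; rewrite inE => /connectP[p + ->].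
elim: p w wA => //= y p IH w wA; rewrite restrict_setC1 => /andP[/and3P[wz yz ewy]].
by apply: IH; apply: step ewy _ _.
Qed.

Lemma branch_notin z w : w != z -> z \notin branch z w.
Proof.
move=> wz; have sub : {subset branch z w <= predC1 z} by exact: sub_branch.
by apply/negP => /sub; rewrite !inE eqxx.
Qed.

Lemma branch_neq z w x : w != z -> x \in branch z w -> x != z.
Proof. by move=> wz; apply: contraTneq => ->; apply: branch_notin. Qed.

Hypothesis treeE : is_tree e.

Let symE : symmetric e. Proof. by case: treeE. Qed.
Let irrE : irreflexive e. Proof. by case: treeE. Qed.
Let connE x y : connect e x y. Proof. by case: treeE. Qed.

Lemma edge_neq x y : e x y -> y != x.
Proof. by apply: contraTneq => ->; rewrite irrE. Qed.

(** Here the absence of cycles enters: a simple path from [w] to another neighbour [x] of [z] that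
    avoids [z] would close to a cycle through [z]. *)
Lemma branch_root z w x : e z w -> x \in branch z w -> e x z -> x = w.
Proof.
move=> ezw; rewrite inE => /connectP[p0 pp0 ->].
case/shortenP: pp0 => p pp up _ ez.
case: p pp up ez => // y p pp up ez.
have [_ _ _ /(_ [:: z, w, y & p] isT)/negP[]] := treeE.
rewrite /ucycleb /= -[w :: y :: p]/([:: w] ++ y :: p).
have sub : path e w (y :: p) && all (predC1 z) (y :: p).
  elim: (y :: p) (w) pp => //= a q IH b; rewrite restrict_setC1.
    by case/andP => /and3P[_ -> ->] /IH.
case/andP: sub => pe pz; apply/andP; split.
  by move: pe => /= /andP[-> pe]; rewrite ezw rcons_path pe.
move: up => /= ->; rewrite andbT !inE !negb_or eq_sym (edge_neq ezw) /=.
by move: pz => /= /andP[/= yz /allP pz]; rewrite eq_sym yz; apply/negP => /pz/=; rewrite eqxx.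
Qed.

Lemma branch_boundary z w x y : e z w -> x \in branch z w -> e x y ->
  y \notin branch z w -> x = w /\ y = z.
Proof.
move=> ezw xB exy yB.
have [yz|yz] := eqVneq y z.
  by split=> //; apply: branch_root ezw xB _; rewrite -yz.
have xz := branch_neq (edge_neq ezw) xB.
by rewrite (branch_step xB exy xz yz) in yB.
Qed.

(** The branches at the two ends of an edge are disjoint because only that edge leaves either of
    them. Their union is closed under adjacency, so by connectivity it is everything. *)
Lemma branch_opposite z w x : e z w ->
  (x \in branch w z) = (x \notin branch z w).
Proof.
move=> ezw; have ewz : e w z by rewrite symE.
have [wz zw] := (edge_neq ezw, edge_neq ewz).
apply/idP/idP => [|xB].
  apply: (sub_branch (A := [predC branch z w])); first exact: branch_notin.
  move=> u v uB euv uw vw; apply: contra uB => vB.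
  have [//|uB] := boolP (u \in _).
  by have [|/eqP] := branch_boundary ezw vB _ uB; rewrite 1?symE // (negPf vw).
pose U := [predU branch z w & branch w z].
have step a b : a \in U -> e a b -> b \in U.
  move=> aU eab; rewrite inE /=; apply/orP.
  have [bB|bB] := boolP (b \in branch z w); [by left|right].
  have [aB|aB] := boolP (a \in branch z w).
    by have [_ ->] := branch_boundary ezw aB eab bB; rewrite branch_self.
  have aB' : a \in branch w z by move: aU; rewrite inE /= (negPf aB).
  have [//|bB'] := boolP (b \in branch w z).
  have [_ bw] := branch_boundary ewz aB' eab bB'.
  by rewrite bw branch_self in bB.
have : x \in U; last by rewrite inE /= (negPf xB).
have wU : w \in U by rewrite inE /= branch_self.
have /connectP[p pp ->] := connE w x; clearbody U.
elim: p w wU pp {ezw ewz wz zw xB} => //= b q IH a aU /andP[eab pq].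
by apply: (IH b) => //; apply: step eab.
Qed.

Lemma branch_child z w c x : e z w -> e w c -> c != z ->
  x \in branch w c -> x \in branch z w.
Proof.
move=> ezw ewc cz; have [wz cw] := (edge_neq ezw, edge_neq ewc).
apply: sub_branch => [|u v uB euv uw vw].
  exact: branch_step (branch_self z w) ewc wz cz.
have [//|vB] := boolP (v \in branch z w).
by have [/eqP] := branch_boundary ezw uB euv vB; rewrite (negPf uw).
Qed.

Lemma branch_cases z w x : e z w -> x \in branch z w -> x != w ->
  exists c, [/\ e w c, c != z & x \in branch w c].
Proof.
move=> ezw xB xw; have wz := edge_neq ezw.
pose A := [pred x | (x == w) || [exists c, [&& e w c, c != z & x \in branch w c]]].
suff: x \in A by rewrite inE (negPf xw) => /existsP[c /and3P[*]]; exists c.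
apply: sub_branch xB; first by rewrite inE eqxx.
move=> u v + euv uz vz; rewrite !inE => /orP[/eqP uw|].
  rewrite uw in euv; apply/orP; right; apply/existsP; exists v.
  by rewrite euv vz branch_self.
have [//|vw /existsP[c /and3P[ewc cz uB]]] := eqVneq v w.
apply/existsP; exists c; rewrite ewc cz /=.
by apply: (branch_step uB euv) => //; apply: branch_neq (edge_neq ewc) uB.
Qed.

Lemma branch_sibling w c c' x : e w c -> e w c' ->
  x \in branch w c -> x \in branch w c' -> c = c'.
Proof.
move=> ewc ewc' xc xc'; apply/eqP; apply: contraTT xc' => cc'.
have ec'w : e c' w by rewrite symE.
by rewrite (branch_opposite _ ec'w) negbK (branch_child ec'w ewc).
Qed.

End Branches.

(** * Sums over branches, by recursion on the root *)

Section BranchSums.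

Variables (V : finType) (e : rel V).
Hypothesis treeE : is_tree e.

Let symE : symmetric e. Proof. by case: treeE. Qed.

Lemma edge_sym x y : e x y -> e y x.
Proof. by rewrite symE. Qed.

Lemma big_branch (M : Type) (idx : M) (op : Monoid.com_law idx) z w (F : V -> M) :
  e z w -> \big[op/idx]_(x in branch e z w) F x =
  op (F w) (\big[op/idx]_(c | e w c && (c != z)) \big[op/idx]_(x in branch e w c) F x).
Proof.
move=> ezw; rewrite (bigD1 w) ?branch_self //=; congr (op _ _).
rewrite (exchange_big_dep (fun x => (x \in branch e z w) && (x != w))) /=; last first.
  move=> c x /andP[ewc cz] xc; rewrite (branch_child treeE ezw ewc cz xc) /=.
  exact: branch_neq (edge_neq treeE ewc) xc.
apply: eq_bigr => x /andP[xB xw].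
have [c [ewc cz xc]] := branch_cases treeE ezw xB xw.
rewrite (big_pred1 c) // => c' /=; apply/andP/eqP => [[/andP[ewc' _] xc']|->].
  exact: (branch_sibling treeE ewc' ewc xc' xc).
by rewrite ewc.
Qed.

Lemma card_branch z w : e z w ->
  #|branch e z w| = (1 + \sum_(c | e w c && (c != z)) #|branch e w c|)%N.
Proof.
move=> ezw; rewrite -sum1_card (big_branch _ _ ezw) /=; congr addn.
by apply: eq_bigr => c _; rewrite sum1_card.
Qed.

Lemma card_branch_gt0 z w : (0 < #|branch e z w|)%N.
Proof. by apply/card_gt0P; exists w; apply: branch_self. Qed.

Lemma card_branch_child z w c : e z w -> e w c -> c != z ->
  (#|branch e w c| < #|branch e z w|)%N.
Proof.
move=> ezw ewc cz; rewrite (card_branch ezw) (bigD1 c) /= ?ewc //; lia.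
Qed.

Lemma card_branch_opposite z w : e z w ->
  (#|branch e z w| + #|branch e w z|)%N = #|V|.
Proof.
move=> ezw; rewrite -(cardC (branch e z w)); congr addn.
by apply: eq_card => x; rewrite !inE -[LHS]in_set (branch_opposite treeE _ ezw) !inE.
Qed.

(** Induction from the leaves towards the root, that is, on the size of the branch. *)
Lemma edge_ind (P : V -> V -> Prop) :
  (forall z w, e z w -> (forall c, e w c -> c != z -> P w c) -> P z w) ->
  forall z w, e z w -> P z w.
Proof.
move=> step z w; have [n] := ubnP #|branch e z w|.
elim: n z w => // n IH z w lt_n ezw; apply: step => // c ewc cz.
by apply: IH => //; have := card_branch_child ezw ewc cz; lia.
Qed.

Variable R : realType.
Implicit Types (beta : V -> V -> R) (gamma g h : V -> R).

(* Each edge inside the branch is met twice in the double sum, the edge [w z] once. *)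
Definition branch_sum beta gamma z w : R :=
  (\sum_(x in branch e z w) \sum_(y | e x y) beta x y - beta w z) / 2
  + \sum_(x in branch e z w) gamma x.

Lemma branch_sum_rec beta gamma z w :
  (forall x y, beta x y = beta y x) -> e z w ->
  branch_sum beta gamma z w =
  gamma w + \sum_(c | e w c && (c != z)) (beta w c + branch_sum beta gamma w c).
Proof.
move=> symb ezw; rewrite /branch_sum !(big_branch _ _ ezw) /= [\sum_(y | e w y) _](bigD1 z) /=.
  rewrite !big_split /= -mulr_suml sumrB.
  have -> : \sum_(c | e w c && (c != z)) beta c w = \sum_(c | e w c && (c != z)) beta w c.
    by apply: eq_bigr.
  by field.
exact: edge_sym.
Qed.

Lemma branch_sum_total beta gamma z w :
  (forall x y, beta x y = beta y x) -> e z w ->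
  (\sum_x \sum_(y | e x y) beta x y) / 2 + \sum_x gamma x =
  beta w z + branch_sum beta gamma z w + branch_sum beta gamma w z.
Proof.
move=> symb ezw.
have split F : \sum_x F x = \sum_(x in branch e z w) F x + \sum_(x in branch e w z) F x :> R.
  rewrite (bigID (mem (branch e z w))) /=; congr (_ + _).
  by apply: eq_bigl => x; rewrite (branch_opposite treeE _ ezw).
by rewrite !split /branch_sum (symb z w); field.
Qed.

Lemma eq_branch_sum beta gamma beta' gamma' z w :
  (forall x y, beta x y = beta y x) -> (forall x y, beta' x y = beta' y x) ->
  e z w -> {in branch e z w &, beta =2 beta'} ->
  {in branch e z w, gamma =1 gamma'} ->
  branch_sum beta gamma z w = branch_sum beta' gamma' z w.
Proof.
move=> symb symb'; move: z w; apply: edge_ind => z w ezw IH eqb eqg.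
rewrite !branch_sum_rec // eqg ?branch_self //; congr (_ + _).
apply: eq_bigr => c /andP[ewc cz].
have sub := branch_child treeE ezw ewc cz.
rewrite eqb ?branch_self ?sub ?branch_self //; congr (_ + _).
by apply: IH => // [x y /sub xB /sub yB|x /sub]; [apply: eqb|apply: eqg].
Qed.

End BranchSums.

(** * Dirichlet energies of branches *)

Section Riccati.

Variables (R : realType) (mu : R).

(** For [x < 1] the minimum of [(a - b) ^+ 2 - x * b ^+ 2] over [b] is [- (x / (1 - x)) * a ^+ 2].
    One step thus eliminates a child carrying the value [x], and [mu] is the contribution of the
    parent itself. *)
Definition riccati_step (x : R) := mu + x / (1 - x).

Definition riccati n := iter n riccati_step 0.

Lemma riccatiS n : riccati n.+1 = mu + riccati n / (1 - riccati n).
Proof. by []. Qed.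

Hypothesis mu_ge0 : 0 <= mu.

Lemma riccati_step_lt x y : x < y -> y < 1 -> riccati_step x < riccati_step y.
Proof.
move=> xy y1; rewrite ltrD2l ltr_pdivrMr; last lra.
rewrite mulrAC ltr_pdivlMr; last lra.
nra.
Qed.

Lemma riccati_ge0 n : (forall j, (j <= n)%N -> riccati j < 1) -> 0 <= riccati n.
Proof.
elim: n => // n IH lt1; rewrite riccatiS addr_ge0 // divr_ge0 //.
  by apply: IH => j jn; apply: lt1; lia.
by rewrite subr_ge0 ltW // lt1.
Qed.

(** Induction on [a]: increasing it by one raises the term for [a + b] at least as much as the term
    for [a]. *)
Lemma riccati_superadditive a b :
  (forall j, (j <= a + b)%N -> riccati j < 1) ->
  riccati a / (1 - riccati a) + riccati b / (1 - riccati b)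
    <= riccati (a + b) / (1 - riccati (a + b)).
Proof.
elim: a => [|a IH] lt1; first by rewrite /= mul0r add0r.
have {}IH := IH (fun j jn => lt1 j (leq_trans jn (leqnSn _))).
have cb0 : 0 <= riccati b / (1 - riccati b).
  rewrite divr_ge0 ?riccati_ge0 // => [j jb|]; first by apply: lt1; lia.
  by rewrite subr_ge0 ltW // lt1 //; lia.
have := lt1 a.+1 ltac:(lia); have := lt1 (a + b).+1 ltac:(lia).
rewrite addSn !riccatiS.
set x := riccati a / _ in IH *; set y := riccati (a + b) / _ in IH *.
set c := riccati b / _ in IH cb0 *.
have x0 : 0 <= x.
  rewrite divr_ge0 ?riccati_ge0 // => [j ja|]; first by apply: lt1; lia.
  by rewrite subr_ge0 ltW // lt1 //; lia.
move=> y1 x1.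
(* The map sending [x] to [(mu + x) / (1 - (mu + x))] is expansive where the denominator lies
   between 0 and 1. *)
have inc : y - x <= (mu + y) / (1 - (mu + y)) - (mu + x) / (1 - (mu + x)).
  have -> : (mu + y) / (1 - (mu + y)) - (mu + x) / (1 - (mu + x))
          = (y - x) / ((1 - (mu + y)) * (1 - (mu + x))).
    by field; apply/andP; split; apply: lt0r_neq0; lra.
  have D0 : 0 <= y - x by lra.
  have p0 : 0 < 1 - (mu + y) by lra.
  have q0 : 0 < 1 - (mu + x) by lra.
  have mu0 := mu_ge0; rewrite ler_pdivlMr ?mulr_gt0 // ler_piMr // mulr_ile1 //; lra.
lra.
Qed.

Lemma riccati_sum_le (I : Type) (r : seq I) (P : pred I) (s : I -> nat) n :
  (forall j, (j <= n)%N -> riccati j < 1) -> (\sum_(i <- r | P i) s i <= n)%N ->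
  \sum_(i <- r | P i) riccati (s i) / (1 - riccati (s i))
    <= riccati (\sum_(i <- r | P i) s i) / (1 - riccati (\sum_(i <- r | P i) s i)).
Proof.
move=> lt1; elim/big_rec2: _ => [_|i m t _ IH le_n]; first by rewrite /= mul0r.
have {}IH := IH ltac:(lia).
apply: le_trans (riccati_superadditive _); last by move=> j jn; apply: lt1; lia.
by rewrite lerD2l.
Qed.

End Riccati.

Section LaplacianBranches.

Variables (R : realType) (V : finType) (e : rel V) (mu : R).
Hypothesis treeE : is_tree e.
Hypothesis mu_ge0 : 0 <= mu.

Let symE : symmetric e. Proof. by case: treeE. Qed.

Implicit Types g h : V -> R.

(* Dirichlet energy minus [mu] times the squared norm of [g] on a branch. *)
Definition energy g z w :=
  branch_sum e (fun x y => (g x - g y) ^+ 2) (fun x => - (mu * g x ^+ 2)) z w.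

Lemma sqr_diffC g x y : (g x - g y) ^+ 2 = (g y - g x) ^+ 2.
Proof. by ring. Qed.

Lemma energy_rec g z w : e z w -> energy g z w =
  - (mu * g w ^+ 2) + \sum_(c | e w c && (c != z)) ((g w - g c) ^+ 2 + energy g w c).
Proof. by apply: branch_sum_rec => //; apply: sqr_diffC. Qed.

Lemma eq_energy g h z w : e z w -> {in branch e z w, g =1 h} ->
  energy g z w = energy h z w.
Proof.
move=> ezw gh; apply: eq_branch_sum => //; try exact: sqr_diffC.
  by move=> x y xB yB /=; rewrite !gh.
by move=> x xB /=; rewrite gh.
Qed.

(* A branch with [n] vertices has at least the energy of the path with [n]
   vertices, because the Riccati recursion is superadditive. *)
Lemma energy_ge g z w : e z w ->
  (forall j, (j <= #|branch e z w|)%N -> riccati mu j < 1) ->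
  - (riccati mu #|branch e z w| * g w ^+ 2) <= energy g z w.
Proof.
move: z w; apply: edge_ind => // z w ezw IH lt1; rewrite energy_rec //.
set S := \sum_(c | _) _.
have cardB := card_branch treeE ezw.
set m := (\sum_(c | _) _)%N in cardB.
rewrite cardB add1n riccatiS in lt1 *.
have km : riccati mu m < 1 by apply: lt1.
suff : - (riccati mu m / (1 - riccati mu m) * g w ^+ 2) <= S by nra.
have lt1m j : (j <= m)%N -> riccati mu j < 1 by move=> jm; apply: lt1; lia.
have := riccati_sum_le mu_ge0 lt1m (leqnn m).
move=> /(ler_wpM2r (sqr_ge0 (g w))) sum_le.
apply: le_trans (_ : - (\sum_(c | e w c && (c != z)) riccati mu #|branch e w c| /
   (1 - riccati mu #|branch e w c|)) * g w ^+ 2 <= _); first by rewrite mulNr lerN2.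
rewrite mulNr -mulNr -sumrN mulr_suml; apply: ler_sum => c /andP[ewc cz].
have cm : (#|branch e w c| <= m)%N by rewrite /m (bigD1 c) /= ?ewc // leq_addr.
have {}IH := IH c ewc cz (fun j jc => lt1m j (leq_trans jc cm)).
apply: le_trans (_ : (g w - g c) ^+ 2 - riccati mu #|branch e w c| * g c ^+ 2 <= _); last first.
  by rewrite lerD2l.
have := lt1m _ cm; set k := riccati mu _ => k1.
(* Completing the square in [g c]. *)
have -> : - (k / (1 - k)) * g w ^+ 2 =
   (g w - g c) ^+ 2 - k * g c ^+ 2 - (g w - (1 - k) * g c) ^+ 2 / (1 - k).
  by field; apply: lt0r_neq0; lra.
by rewrite lerBlDr lerDl divr_ge0 ?sqr_ge0 //; lra.
Qed.

(** Counterpart of [energy_ge] in the other direction: a trial function normalised at the root, for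
    which [a] plays the part of a Riccati value. *)
Definition low_energy z w a :=
  exists g, [/\ forall x, 0 <= g x, g w = 1 & energy g z w <= - a].

Lemma low_energy_weaken z w a b : b <= a -> low_energy z w a -> low_energy z w b.
Proof. by move=> ba [g [g0 gw ga]]; exists g; split=> //; lra. Qed.

Lemma energy_const g c z w : e z w -> {in branch e z w, g =1 fun=> c} ->
  energy g z w = - (mu * c ^+ 2) *+ #|branch e z w|.
Proof.
move=> ezw gc; rewrite (eq_energy ezw gc) /energy /branch_sum subrr expr0n /=.
rewrite big1 => [|x _]; last by rewrite big1.
by rewrite subrr mul0r add0r sumr_const.
Qed.

(** The trial function is 1 at the root and [b] elsewhere, where [b] is optimal for a child that is
    a leaf. A child branch with [s] vertices then does at least as well as [s] leaves. *)
Lemma low_energy_base z w : e z w -> mu < 1 ->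
  low_energy z w (mu + (#|branch e z w|.-1)%:R * (mu / (1 - mu))).
Proof.
move=> ezw mu1; pose b := (1 - mu)^-1.
have b0 : 0 <= b by rewrite invr_ge0; lra.
exists (fun x => if x == w then 1 else b); split; rewrite ?eqxx //.
  by move=> x; case: eqP.
rewrite energy_rec // eqxx expr1n mulr1 opprD lerD2l.
have -> : (#|branch e z w|.-1 = \sum_(c | e w c && (c != z)) #|branch e w c|)%N.
  by rewrite (card_branch treeE ezw) add1n.
rewrite natr_sum mulr_suml -sumrN; apply: ler_sum => c /andP[ewc cz].
have cw := edge_neq treeE ewc.
rewrite (negPf cw) (@energy_const _ b) //; last first.
  by move=> x /(branch_neq cw) xw; rewrite (negPf xw).
have : 1 <= #|branch e w c|%:R :> R by rewrite ler1n card_branch_gt0.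
rewrite -[X in _ + X <= _]mulr_natr; set s := _%:R => s1.
have -> : (1 - b) ^+ 2 + - (mu * b ^+ 2) * s = - (s * (mu / (1 - mu))) - (s - 1) * (mu * b) ^+ 2.
  by rewrite /b; field; apply: lt0r_neq0; lra.
by rewrite lerBlDr lerDl mulr_ge0 ?sqr_ge0 //; lra.
Qed.

(** The factor [k] minimises [(1 - k) ^+ 2 - a * k ^+ 2]. At [z] and on its other child branches the
    new function is 1, so those branches contribute nonpositive energy. *)
Lemma low_energy_step z' z w a : e z' z -> e z w -> w != z' -> a < 1 ->
  low_energy z w a -> low_energy z' z (riccati_step mu a).
Proof.
move=> ez'z ezw wz' a1 [g [g0 gw ga]]; pose k := (1 - a)^-1.
have k0 : 0 < k by rewrite invr_gt0; lra.
exists (fun x => if x \in branch e z w then k * g x else 1); split.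
- by move=> x; case: ifP => // _; rewrite mulr_ge0 // ltW.
- by rewrite (negPf (branch_notin _ _)) // (edge_neq treeE).
have zB := branch_notin e (edge_neq treeE ezw).
rewrite energy_rec // (negPf zB) expr1n mulr1 opprD lerD2l.
rewrite (bigD1 w) ?ezw //= branch_self gw mulr1.
rewrite (@eq_energy _ (fun x => k * g x)) //; last by move=> x ->.
have -> : energy (fun x => k * g x) z w = k ^+ 2 * energy g z w.
  rewrite /energy /branch_sum mulrDr mulrA mulrBr !mulr_sumr; congr (_ / _ + _).
    rewrite -mulrBr exprMn; congr (_ - _); apply: eq_bigr => x _.
    by rewrite mulr_sumr; apply: eq_bigr => y _; rewrite -mulrBr exprMn.
  by apply: eq_bigr => x _; ring.
have kE : (1 - k * 1) ^+ 2 + k ^+ 2 * - a = - (a / (1 - a)).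
  by rewrite /k; field; apply: lt0r_neq0; lra.
rewrite [k * 1]mulr1 in kE; rewrite -kE -[leRHS]addr0.
apply: lerD; first by rewrite lerD2l ler_wpM2l ?sqr_ge0.
apply: sumr_le0 => c /andP[/andP[ezc cz'] cw].
have -> : (c \in branch e z w) = false.
  by apply: contraNF cw => cB; apply/eqP; apply: branch_sibling cB => //; apply: branch_self.
rewrite subrr expr0n add0r (@energy_const _ 1) //; last first.
  move=> x xc; have [xB|//] := boolP (x \in branch e z w).
  by rewrite (branch_sibling treeE ezc ezw xc xB) eqxx in cw.
by rewrite expr1n mulr1 mulNrn oppr_le0 mulrn_wge0.
Qed.

End LaplacianBranches.

(** * Truncation of an eigenfunction to a branch *)

Section PositivePart.

Variables (R : realType) (V : finType) (e : rel V).
Hypothesis treeE : is_tree e.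

Variables (f : V -> R) (v w : V).

Definition branch_positive_part x :=
  if x \in branch e v w then Num.max (f x) 0 else 0.

Lemma branch_positive_part_ge0 x : 0 <= branch_positive_part x.
Proof. by rewrite /branch_positive_part; case: ifP => // _; rewrite le_max lexx orbT. Qed.

Lemma branch_positive_part_out x : x \notin branch e v w -> branch_positive_part x = 0.
Proof. by rewrite /branch_positive_part => /negPf ->. Qed.

(** Where the truncation is nonzero it agrees with [f], and it dominates [f] at the neighbours: a
    neighbour outside the branch can only be [v], where [f] is nonpositive. This is what compares
    Rayleigh quotients with the eigenvalue of [f]. *)
Lemma branch_positive_part_neq0 x : e v w -> f v <= 0 -> branch_positive_part x != 0 ->
  branch_positive_part x = f x /\ forall y, e x y -> f y <= branch_positive_part y.
Proof.
move=> evw fv gx.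
have xB : x \in branch e v w by apply: contraNT gx => /branch_positive_part_out ->.
split=> [|y exy].
  by apply/eqP; move: gx; rewrite /branch_positive_part xB; case: leP => //; rewrite eqxx.
rewrite /branch_positive_part; case: ifP => [_|/negbT yB]; first by rewrite le_max lexx.
by have [_ ->] := branch_boundary treeE evw xB exy yB.
Qed.

End PositivePart.

(** * Consequences of the minimality of the algebraic connectivity *)

Section LaplacianSide.

Variables (R : realType) (V : finType) (e : rel V) (mu : R).
Hypothesis treeE : is_tree e.
Hypothesis mu_ge0 : 0 <= mu.

Let symE : symmetric e. Proof. by case: treeE. Qed.

Implicit Types g h : V -> R.

Lemma energy0 g z w : e z w -> {in branch e z w, g =1 fun=> 0} ->
  energy e mu g z w = 0.
Proof.
move=> ezw g0; rewrite (energy_const mu treeE ezw g0).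
by rewrite expr0n mulr0 oppr0 mul0rn.
Qed.

Lemma energy_total g z w : e z w ->
  dirichlet e g / 2 - mu * \sum_x g x ^+ 2
    = (g w - g z) ^+ 2 + energy e mu g z w + energy e mu g w z.
Proof.
move=> ezw; rewrite /energy -(branch_sum_total treeE _ (@sqr_diffC _ _ _) ezw).
by rewrite mulr_sumr sumrN.
Qed.

Lemma energy_supported g z w : e z w -> (forall x, x \notin branch e z w -> g x = 0) ->
  dirichlet e g / 2 - mu * \sum_x g x ^+ 2 = g w ^+ 2 + energy e mu g z w.
Proof.
move=> ezw g0; have ewz : e w z by rewrite symE.
rewrite (energy_total g ezw) (g0 z) ?branch_notin ?(edge_neq treeE ezw) //.
rewrite (energy0 ewz) ?addr0 ?subr0 // => x.
by rewrite (branch_opposite treeE _ ezw) => /g0.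
Qed.

(* A certificate that the Dirichlet eigenvalue of [branch e v w] is at most [mu]. *)
Definition perron_branch v w := exists g,
  [/\ forall x, 0 <= g x, 0 < g w, forall x, x \notin branch e v w -> g x = 0
    & dirichlet e g <= 2 * mu * \sum_x g x ^+ 2].

Lemma perron_branch_positive_part (f : V -> R) v w : e v w ->
  laplace e f =1 (fun x => mu * f x) -> f v <= 0 -> 0 < f w -> perron_branch v w.
Proof.
move=> evw fmu fv fw; set g := branch_positive_part e f v w.
exists g; split.
- exact: branch_positive_part_ge0.
- by rewrite /g /branch_positive_part branch_self lt_max fw.
- exact: branch_positive_part_out.
rewrite dirichletE // -mulrA ler_pM2l // mulr_sumr; apply: ler_sum => x _.
have [gx0|gx] := eqVneq (g x) 0; first by rewrite gx0 mul0r expr0n mulr0.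
have [gfx gfy] := branch_positive_part_neq0 treeE evw fv gx.
rewrite -/g in gfx gfy.
rewrite expr2 mulrCA ler_wpM2l ?branch_positive_part_ge0 // gfx -fmu /laplace.
by apply: ler_sum => y exy; rewrite gfx lerD2l lerN2 gfy.
Qed.

(** If all these Riccati values were below 1, then [energy_ge] and the edge from [w] to [v], which
    contributes [g w ^+ 2], would leave at least [(1 - k) * g w ^+ 2 > 0], against the bound on the
    Dirichlet energy. *)
Lemma perron_branch_riccati v w : e v w -> perron_branch v w ->
  ~ (forall j, (j <= #|branch e v w|)%N -> riccati mu j < 1).
Proof.
move=> evw [g [g0 gw gout gE]] lt1.
have := energy_ge treeE mu_ge0 g evw lt1; have := energy_supported evw gout.
have := lt1 _ (leqnn _); set k := riccati _ _ => k1.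
have : 0 < g w ^+ 2 by rewrite exprn_gt0.
by nra.
Qed.

Hypothesis min_mu : forall g, \sum_x g x = 0 ->
  2 * mu * \sum_x g x ^+ 2 <= dirichlet e g.

Lemma dirichlet_disjoint g h t : (forall x y, e x y || (x == y) -> g x * h y = 0) ->
  dirichlet e (fun x => g x - t * h x) = dirichlet e g + t ^+ 2 * dirichlet e h.
Proof.
move=> gh; rewrite /dirichlet mulr_sumr -big_split; apply: eq_bigr => x _ /=.
rewrite mulr_sumr -big_split; apply: eq_bigr => y exy /=.
have := gh x x; have := gh y y; have := gh x y; have := gh y x.
rewrite exy (symE y x) exy !eqxx !orbT => /(_ isT) yx /(_ isT) xy /(_ isT) yy /(_ isT) xx.
transitivity ((g x - g y) ^+ 2 + t ^+ 2 * (h x - h y) ^+ 2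
   - 2 * t * (g x * h x + g y * h y - g x * h y - g y * h x)); first by ring.
by rewrite xx yy xy yx !subr0 addr0 mulr0 subr0.
Qed.

(** If [a > 1], the trial function cut off outside its branch has Rayleigh quotient below [mu].
    Combined with the one on the branch towards [w] it yields a zero-sum function that violates
    [min_mu]. *)
Lemma low_energy_le1 v v' w z u a : e v v' -> e v w -> v' != w -> e z u ->
  {subset branch e z u <= branch e v v'} -> perron_branch v w ->
  low_energy e mu z u a -> a <= 1.
Proof.
move=> evv' evw v'w ezu sub [g [g0 gw gout gE]] [h [h0 hu hE]].
rewrite leNgt; apply/negP => a1.
pose h' x := if x \in branch e z u then h x else 0.
have h'out x : x \notin branch e z u -> h' x = 0 by rewrite /h' => /negPf ->.
have h'E : energy e mu h' z u = energy e mu h z u.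
  by apply: eq_energy => // x xB; rewrite /h' xB.
have h'u : h' u = 1 by rewrite /h' branch_self.
have := energy_supported ezu h'out; rewrite h'E h'u expr1n => Eh'.
have sum_gt0 (k : V -> R) y : (forall x, 0 <= k x) -> 0 < k y -> 0 < \sum_x k x.
  by move=> k0 ky; rewrite (bigD1 y) //= ltr_pwDl // sumr_ge0.
have sg := sum_gt0 g w g0 gw.
(* Chosen so that [h' - t * g] has zero sum. *)
pose t := (\sum_x h' x) / (\sum_x g x).
(* The supports lie in different branches at [v], so they are disjoint and no edge joins them. *)
have disj x y : e x y || (x == y) -> h' x * g y = 0.
  move=> xy; have [xB|/h'out ->] := boolP (x \in branch e z u); last by rewrite mul0r.
  have [yB|/gout ->] := boolP (y \in branch e v w); last by rewrite mulr0.
  case/negP: v'w; case/orP: xy => [exy|/eqP xy].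
    have [yB'|yB'] := boolP (y \in branch e v v').
      by apply/eqP/(branch_sibling treeE evv' evw yB').
    have [_ yv] := branch_boundary treeE evv' (sub _ xB) exy yB'.
    by have := branch_neq (edge_neq treeE evw) yB; rewrite yv eqxx.
  by apply/eqP/(branch_sibling treeE evv' evw (sub _ xB)); rewrite xy.
have /min_mu : \sum_x (h' x - t * g x) = 0.
  by rewrite sumrB -mulr_sumr /t divfK ?subrr ?gt_eqF.
rewrite dirichlet_disjoint //.
have -> : \sum_x (h' x - t * g x) ^+ 2 = \sum_x h' x ^+ 2 + t ^+ 2 * \sum_x g x ^+ 2.
  rewrite mulr_sumr -big_split; apply: eq_bigr => x _ /=.
  have := disj x x; rewrite eqxx orbT => /(_ isT) hg.
  transitivity (h' x ^+ 2 + t ^+ 2 * g x ^+ 2 - 2 * t * (h' x * g x)); first by ring.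
  by rewrite hg mulr0 subr0.
have := ler_wpM2l (sqr_ge0 t) gE.
move: Eh' hE a1; lra.
Qed.

End LaplacianSide.

(** * Rayleigh quotients of the adjacency matrix *)

Section AdjacencySide.

Variables (R : realType) (V : finType) (e : rel V).
Hypothesis treeE : is_tree e.

Let symE : symmetric e. Proof. by case: treeE. Qed.
Let irrE : irreflexive e. Proof. by case: treeE. Qed.

Implicit Types (f g h : V -> R) (A : {set V}).

Definition adj_form h := \sum_x h x * neighbor_sum e h x.

Definition rayleigh_bounded A (s : R) := forall h,
  (forall x, x \notin A -> h x = 0) -> adj_form h <= s * \sum_x h x ^+ 2.

(* A vector attaining the maximum of the Rayleigh quotient is an eigenvector:
   perturb it at a single vertex. *)
Lemma rayleigh_eigenfunction A s g : rayleigh_bounded A s ->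
  (forall x, x \notin A -> g x = 0) -> s * \sum_x g x ^+ 2 <= adj_form g ->
  {in A, neighbor_sum e g =1 (fun x => s * g x)}.
Proof.
move=> bound gout gs a aA; pose d x : R := (x == a)%:R.
have dsum F : \sum_x d x * F x = F a.
  rewrite (bigD1 a) //= /d eqxx mul1r big1 ?addr0 // => x /negPf->.
  by rewrite mul0r.
have expand t : adj_form (fun x => g x + t * d x)
    = adj_form g + 2 * t * neighbor_sum e g a.
  have swap : \sum_x g x * neighbor_sum e d x = neighbor_sum e g a.
    rewrite -[RHS]dsum /neighbor_sum.
    under eq_bigr do rewrite mulr_sumr.
    rewrite (exchange_big_dep xpredT) //=; apply: eq_bigr => y _.
    by rewrite mulr_sumr; apply: eq_big => [x|x _]; [rewrite symE|rewrite mulrC].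
  have dd : neighbor_sum e d a = 0.
    by rewrite /neighbor_sum big1 // => y; rewrite /d; case: eqP => // ->; rewrite irrE.
  transitivity (adj_form g + t * (\sum_x d x * neighbor_sum e g x)
      + t * (\sum_x g x * neighbor_sum e d x) + t ^+ 2 * (\sum_x d x * neighbor_sum e d x)).
    rewrite /adj_form !mulr_sumr -!big_split; apply: eq_bigr => x _ /=.
    rewrite /neighbor_sum big_split /= -mulr_sumr; ring.
  by rewrite !dsum swap dd; ring.
have expand2 t : \sum_x (g x + t * d x) ^+ 2 = \sum_x g x ^+ 2 + 2 * t * g a + t ^+ 2.
  transitivity (\sum_x g x ^+ 2 + 2 * t * (\sum_x d x * g x) + t ^+ 2 * (\sum_x d x * d x)).
    by rewrite !mulr_sumr -!big_split; apply: eq_bigr => x _ /=; ring.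
  by rewrite !dsum /d eqxx mulr1.
have key t : 2 * t * (neighbor_sum e g a - s * g a) <= s * t ^+ 2.
  have : adj_form (fun x => g x + t * d x) <= s * \sum_x (g x + t * d x) ^+ 2.
    apply: bound => x xA; rewrite gout // /d; case: eqP => [xa|_]; last by rewrite mulr0 addr0.
    by rewrite xa aA in xA.
  rewrite expand expand2; lra.
apply/eqP; rewrite -subr_eq0; set w := _ - _ in key *.
have := ler_norm s; set M := `|s| => sM; have M0 : 0 <= M by apply: normr_ge0.
(* With this choice [key] becomes [2 * (M + 1) * w ^+ 2 <= s * w ^+ 2], and [s <= M] forces
   [w = 0]. *)
have := key (w / (M + 1)); rewrite exprMn exprVn => kw.
have M1 : M + 1 != 0 by apply: lt0r_neq0; lra.
have {kw} : 2 * (M + 1) * w ^+ 2 <= s * w ^+ 2.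
  have -> : 2 * (M + 1) * w ^+ 2 = 2 * (w / (M + 1)) * w * (M + 1) ^+ 2 by field.
  have -> : s * w ^+ 2 = s * (w ^+ 2 / (M + 1) ^+ 2) * (M + 1) ^+ 2 by field.
  by rewrite ler_wpM2r ?sqr_ge0.
have := sqr_ge0 w; rewrite -(sqrf_eq0 w) => w0 ww; apply/eqP; nra.
Qed.

Lemma adj_form_positive_part f v w s : e v w -> f v <= 0 ->
  neighbor_sum e f =1 (fun x => s * f x) ->
  s * \sum_x branch_positive_part e f v w x ^+ 2
    <= adj_form (branch_positive_part e f v w).
Proof.
move=> evw fv fs; set g := branch_positive_part e f v w.
rewrite mulr_sumr; apply: ler_sum => x _.
have [->|gx] := eqVneq (g x) 0; first by rewrite mul0r expr0n mulr0.
have [gfx gfy] := branch_positive_part_neq0 treeE evw fv gx; rewrite -/g in gfx gfy.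
rewrite expr2 mulrCA ler_wpM2l ?branch_positive_part_ge0 // gfx -fs.
exact: ler_sum.
Qed.

Lemma branch_nonpos f v w : {in branch e v w, branch_positive_part e f v w =1 fun=> 0} ->
  {in branch e v w, forall x, f x <= 0}.
Proof.
move=> g0 x xB; have := g0 x xB; rewrite /branch_positive_part xB => <-.
by rewrite le_max lexx.
Qed.

(** A nonzero truncation would have Rayleigh quotient at least [s], above the bound [s']. *)
Lemma branch_nonpos_of_bounded f v w s s' : e v w -> f v <= 0 ->
  neighbor_sum e f =1 (fun x => s * f x) -> s' < s ->
  rayleigh_bounded (branch e v w) s' -> {in branch e v w, forall x, f x <= 0}.
Proof.
move=> evw fv fs ss' bound; apply: branch_nonpos => x xB.
have := adj_form_positive_part evw fv fs; set g := branch_positive_part e f v w.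
have := bound g (@branch_positive_part_out _ _ _ f v w).
have g2 : 0 <= \sum_x g x ^+ 2 by apply: sumr_ge0 => y _; apply: sqr_ge0.
move=> le1 le2; have /eqP : \sum_x g x ^+ 2 = 0 by nra.
rewrite psumr_eq0 => [/allP/(_ x (mem_index_enum _))|y _]; last exact: sqr_ge0.
by rewrite sqrf_eq0 => /eqP.
Qed.

(* Otherwise [f] would vanish at [v0] and on all branches at [v0] other than the
   one towards [v1], hence at [v1] too. *)
Lemma heavy_branch f v0 v1 s s' : e v0 v1 ->
  neighbor_sum e f =1 (fun x => s * f x) ->
  (exists x, 0 < f x) -> (exists x, f x < 0) ->
  rayleigh_bounded (branch e v0 v1) s -> s' < s ->
  ~ (forall u, e v0 u -> u != v1 -> rayleigh_bounded (branch e v0 u) s').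
Proof.
move=> e01; wlog f0 : f / f v0 <= 0.
  move=> wl fs [x fx] [y fy].
  have [f0|f0] := leP (f v0) 0; first by apply: (wl f) => //; [exists x|exists y].
  apply: (wl (fun x => - f x)); rewrite ?oppr_le0 ?ltW //.
  - by move=> z; rewrite /neighbor_sum sumrN -/(neighbor_sum e f z) fs mulrN.
  - by exists y; rewrite oppr_gt0.
  - by exists x; rewrite oppr_lt0.
move=> fs [p fp] _ bound1 ss' bound.
have others u : e v0 u -> u != v1 -> {in branch e v0 u, forall x, f x <= 0}.
  by move=> e0u u1; apply: branch_nonpos_of_bounded ss' (bound u e0u u1).
set g := branch_positive_part e f v0 v1.
have gout x : x \notin branch e v0 v1 -> g x = 0 by apply: branch_positive_part_out.
have g0 x : 0 <= g x by apply: branch_positive_part_ge0.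
have gE := rayleigh_eigenfunction bound1 gout (adj_form_positive_part e01 f0 fs).
have v1B := branch_self e v0 v1.
(* A zero of the nonnegative eigenfunction [g] spreads to all neighbours in the branch; then [f]
   would be nonpositive everywhere, although [f p > 0]. *)
have gv1 : g v1 != 0.
  apply: contraTneq fp => gv1; rewrite -leNgt.
  have gz x : x \in branch e v0 v1 -> g x == 0.
    apply: (sub_branch (A := [pred x | g x == 0])); first by rewrite inE gv1.
    move=> a b; rewrite !inE => /eqP ga eab av0 bv0.
    have [bB|/gout->//] := boolP (b \in branch e v0 v1).
    have aB : a \in branch e v0 v1 by apply: branch_step bB _ bv0 av0; rewrite symE.
    have /eqP := gE a aB; rewrite ga mulr0 /neighbor_sum psumr_eq0 //.
    by move=> /allP/(_ b (mem_index_enum _)); rewrite eab.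
  have [pB|pB] := boolP (p \in branch e v0 v1).
    by apply: branch_nonpos pB => x /gz/eqP.
  have [->//|p0] := eqVneq p v0.
  have e10 : e v1 v0 by rewrite symE.
  have pB' : p \in branch e v1 v0 by rewrite (branch_opposite treeE _ e01).
  have [c [e0c cv1 pc]] := branch_cases treeE e10 pB' p0.
  exact: others pc.
have [gf gfy] := branch_positive_part_neq0 treeE e01 f0 gv1; rewrite -/g in gf gfy.
have fv1 : f v1 != 0 by rewrite -gf.
(* At [v1] the functions [f] and [g] satisfy the same eigenvalue equation with equal values. As [g]
   dominates [f] at all neighbours, it equals [f] there, and [g v0 = 0]. *)
have fv0 : f v0 = 0.
  have : \sum_(y | e v1 y) (g y - f y) = 0.
    by rewrite sumrB -/(neighbor_sum e g v1) gE // gf -fs subrr.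
  move/eqP; rewrite psumr_eq0 => [/allP/(_ v0 (mem_index_enum _))|y]; last first.
    by move=> /gfy; rewrite subr_ge0.
  rewrite symE e01 /= gout; last by rewrite branch_notin // (edge_neq treeE).
  by rewrite sub0r oppr_eq0 => /eqP.
(* Since [f v0 = 0], the sign argument applies to [f] and to its negative. The equation at [v0] then
   leaves only [f v1], which is nonzero. *)
have others0 u : e v0 u -> u != v1 -> f u = 0.
  move=> e0u u1; apply/eqP; rewrite eq_le (others u) ?branch_self //=.
  rewrite -oppr_le0; apply: (@branch_nonpos_of_bounded (fun x => - f x) v0 u s s');
    rewrite ?branch_self ?fv0 ?oppr0 //; last exact: bound.
  by move=> z; rewrite /neighbor_sum sumrN -/(neighbor_sum e f z) fs mulrN.
have := fs v0; rewrite fv0 mulr0 /neighbor_sum (bigD1 v1) //= big1 ?addr0.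
  by move/eqP; rewrite (negPf fv1).
by move=> u /andP[]; apply: others0.
Qed.

(** The factor 2 is there because [branch_sum] takes each edge once and [adj_form] takes it
    twice. *)
Definition adj_energy s h z w :=
  branch_sum e (fun x y => 2 * (h x * h y)) (fun x => - (s * h x ^+ 2)) z w.

Lemma adj_energy_rec s h z w : e z w -> adj_energy s h z w =
  - (s * h w ^+ 2)
  + \sum_(c | e w c && (c != z)) (2 * (h w * h c) + adj_energy s h w c).
Proof. by apply: branch_sum_rec => // x y; rewrite (mulrC (h x)). Qed.

Lemma eq_adj_energy s g h z w : e z w -> {in branch e z w, g =1 h} ->
  adj_energy s g z w = adj_energy s h z w.
Proof.
move=> ezw gh; apply: eq_branch_sum => // [x y|x y|x y xB yB|x xB] /=.
- by rewrite (mulrC (g x)).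
- by rewrite (mulrC (h x)).
- by rewrite !gh.
- by rewrite gh.
Qed.

Lemma adj_energy_const s h c z w : e z w -> {in branch e z w, h =1 fun=> c} ->
  adj_energy s h z w = c ^+ 2 * (2 * (#|branch e z w|%:R - 1) - s * #|branch e z w|%:R).
Proof.
move=> ezw hc; rewrite (eq_adj_energy s ezw hc); move: z w ezw {hc}.
apply: edge_ind => // z w ezw IH; rewrite adj_energy_rec // (card_branch treeE ezw).
rewrite (eq_bigr (fun c' => c ^+ 2 * (2 - s) * #|branch e w c'|%:R)) => [|c' /andP[ewc' cz]].
  by rewrite -mulr_sumr natrD natr_sum; ring.
by rewrite IH //; ring.
Qed.

Lemma adj_energy_supported s h z w : e z w -> (forall x, x \notin branch e z w -> h x = 0) ->
  adj_form h - s * \sum_x h x ^+ 2 = adj_energy s h z w.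
Proof.
move=> ezw hout; have ewz : e w z by rewrite symE.
have symb x y : 2 * (h x * h y) = 2 * (h y * h x) by rewrite (mulrC (h x)).
have := branch_sum_total treeE (fun x => - (s * h x ^+ 2)) symb ezw.
rewrite (hout z) ?branch_notin ?(edge_neq treeE ezw) // mulr0 mulr0 add0r.
have -> : branch_sum e (fun x y => 2 * (h x * h y)) (fun x => - (s * h x ^+ 2)) w z = 0.
  rewrite -/(adj_energy s h w z) (@adj_energy_const _ _ 0) ?expr0n ?mul0r // => x.
  by rewrite (branch_opposite treeE _ ezw) => /hout.
rewrite addr0 -/(adj_energy s h z w) => <-; congr (_ + _); last by rewrite mulr_sumr sumrN.
rewrite /adj_form mulr_suml; apply: eq_bigr => x _.
rewrite mulr_sumr mulr_suml; by apply: eq_bigr => y _; field.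
Qed.

(* The star maximises the spectral radius among trees with [k + 1] vertices. *)
Lemma adj_energy_le s k h z w : 0 < s -> s ^+ 2 = k%:R -> e z w ->
  (#|branch e z w| <= k.+1)%N ->
  adj_energy s h z w <= (#|branch e z w|%:R - 1 - k%:R) / s * h w ^+ 2.
Proof.
move=> s0 sk; move: z w; apply: edge_ind => // z w ezw IH le_k.
rewrite adj_energy_rec //.
have -> : (#|branch e z w|%:R - 1 - k%:R) / s * h w ^+ 2 = - (s * h w ^+ 2) +
   \sum_(c | e w c && (c != z)) (#|branch e w c|%:R / s * h w ^+ 2).
  rewrite -mulr_suml -mulr_suml -natr_sum (card_branch treeE ezw) natrD -sk.
  by field; apply: lt0r_neq0.
rewrite lerD2l; apply: ler_sum => c /andP[ewc cz].
have lt_c := card_branch_child treeE ezw ewc cz.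
have {}IH := IH c ewc cz ltac:(lia).
have : (1 : R) <= #|branch e w c|%:R by rewrite ler1n card_branch_gt0.
have : #|branch e w c|%:R <= k%:R :> R by rewrite ler_nat; lia.
move: IH; set m := #|branch e w c|%:R; set K : R := k%:R.
set T := adj_energy _ _ _ _; set x := h w; set y := h c => IH mk m1.
suff : 2 * (x * y) + (m - 1 - K) / s * y ^+ 2 <= m / s * x ^+ 2 by lra.
rewrite -subr_ge0.
(* Completing the square; the remaining coefficient [m * (K + 1 - m) - K] is [(m - 1) * (K - m)],
   nonnegative for [1 <= m <= K]. *)
have -> : m / s * x ^+ 2 - (2 * (x * y) + (m - 1 - K) / s * y ^+ 2)
  = ((m * x - s * y) ^+ 2 + (m * (K + 1 - m) - K) * y ^+ 2) / (m * s).
  have -> : m * (K + 1 - m) - K = m * (K + 1 - m) - s ^+ 2 by rewrite sk.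
  by field; rewrite !lt0r_neq0 //; lra.
apply: divr_ge0; last by rewrite mulr_ge0 //; lra.
by rewrite addr_ge0 ?sqr_ge0 // mulr_ge0 ?sqr_ge0 //; nra.
Qed.

Lemma small_branch_bounded s k z w : 0 < s -> s ^+ 2 = k%:R -> e z w ->
  (#|branch e z w| <= k.+1)%N -> rayleigh_bounded (branch e z w) s.
Proof.
move=> s0 sk ezw le_k h hout; rewrite -subr_le0 (adj_energy_supported s ezw hout).
apply: le_trans (adj_energy_le h s0 sk ezw le_k) _.
rewrite mulr_le0_ge0 ?sqr_ge0 // mulr_le0_ge0 ?invr_ge0 ?(ltW s0) //.
by rewrite -addrA -opprD subr_le0 nat1r ler_nat.
Qed.

(* Test vector: [3/5] at [v1] and [1] on the branch from [v1] towards [v2]. *)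
Lemma rayleigh_bounded_ge v0 v1 v2 s : e v0 v1 -> e v1 v2 -> v2 != v0 ->
  rayleigh_bounded (branch e v0 v1) s ->
  2 * #|branch e v1 v2|%:R - 4 / 5 <= s * (#|branch e v1 v2|%:R + 9 / 25).
Proof.
move=> e01 e12 v20 bound.
(* The bound must exceed 1 when the branch at [v2] has two vertices and [sqrt 3] when it has six.
   The value [3 / 5] gives [280 / 159] for six vertices, whereas the value 1 would only give
   [12 / 7 < sqrt 3]. *)
pose h x : R := if x == v1 then 3 / 5 else if x \in branch e v1 v2 then 1 else 0.
have v1B := branch_notin e (edge_neq treeE e12).
have hout x : x \notin branch e v0 v1 -> h x = 0.
  rewrite /h; have [->|_] := eqVneq; first by rewrite branch_self.
  by case: ifP => // xB; rewrite (branch_child treeE e01 e12 v20 xB).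
have := bound h hout; rewrite -subr_le0 (adj_energy_supported s e01 hout).
have hv1 : h v1 = 3 / 5 by rewrite /h eqxx.
have h2 : {in branch e v1 v2, h =1 fun=> 1}.
  by move=> x xB; rewrite /h xB; case: eqP => // xv; by rewrite xv (negPf v1B) in xB.
rewrite adj_energy_rec // (bigD1 v2) /= ?e12 // hv1 h2 ?branch_self //.
rewrite (adj_energy_const s e12 h2) big1 ?addr0; first by lra.
move=> c /andP[/andP[e1c cv0] cv2].
have h0 : {in branch e v1 c, h =1 fun=> 0}.
  move=> x xc; have xv1 := branch_neq (edge_neq treeE e1c) xc.
  rewrite /h (negPf xv1); case: ifP => // xB.
  by rewrite (branch_sibling treeE e1c e12 xc xB) eqxx in cv2.
by rewrite (adj_energy_const s e1c h0) h0 ?branch_self // expr0n mul0r !mulr0 addr0.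
Qed.

End AdjacencySide.

(** * Branches and the Riccati recursion along a walk *)

Section Walk.

Variables (V : finType) (e : rel V).
Hypothesis treeE : is_tree e.

Let symE : symmetric e. Proof. by case: treeE. Qed.

Definition nonbacktracking_walk (x : nat -> V) n :=
  (forall i, (i < n)%N -> e (x i) (x i.+1)) /\
  (forall i, (i.+1 < n)%N -> x i != x i.+2).

Section OneWalk.

Variables (x : nat -> V) (n : nat).
Hypothesis walkx : nonbacktracking_walk x n.

Lemma walk_back i : (i < n)%N -> e (x i.+1) (x i).
Proof. by move=> lt_i; rewrite symE; apply: walkx.1. Qed.

Lemma walk_branch_sub i j : (i <= j)%N -> (j < n)%N ->
  {subset branch e (x i.+1) (x i) <= branch e (x j.+1) (x j)}.
Proof.
elim: j => [|j IH]; first by rewrite leqn0 => /eqP-> _ y.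
rewrite leq_eqVlt ltnS => /orP[/eqP-> _ y //|ij] jn y yB.
have yB' := IH ij (ltnW jn) y yB.
exact: (branch_child treeE (walk_back jn) (walk_back (ltnW jn)) (walkx.2 _ jn) yB').
Qed.

Lemma walk_card_back i : (i < n)%N ->
  (i + #|branch e (x 1%N) (x 0%N)| <= #|branch e (x i.+1) (x i)|)%N.
Proof.
elim: i => // i IH lt_i; have {}IH := IH (ltnW lt_i).
have := card_branch_child treeE (walk_back lt_i) (walk_back (ltnW lt_i)) (walkx.2 _ lt_i).
lia.
Qed.

Lemma walk_card_forward i j : (i <= j)%N -> (j < n)%N ->
  (j - i + #|branch e (x j) (x j.+1)| <= #|branch e (x i) (x i.+1)|)%N.
Proof.
elim: j => [|j IH]; first by rewrite leqn0 => /eqP->; rewrite subnn.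
rewrite leq_eqVlt ltnS => /orP[/eqP->|ij] jn; first by rewrite subnn.
have {}IH := IH ij (ltnW jn).
have := card_branch_child treeE (walkx.1 _ (ltnW jn)) (walkx.1 _ jn).
rewrite eq_sym walkx.2 // => /(_ isT); lia.
Qed.

End OneWalk.

Section Blowup.

Variables (R : realType) (mu : R).
Hypothesis mu_gt0 : 0 < mu.
Hypothesis min_mu : forall g : V -> R, \sum_x g x = 0 ->
  2 * mu * \sum_x g x ^+ 2 <= dirichlet e g.

(** Indices are shifted by one against the overview: [x 0] is the neighbour [u] of v_0, [x i.+1] is
    v_i for [i <= d], and [x d.+2] is the root of Y. *)
Variables (x : nat -> V) (d : nat).
Hypothesis walkx : nonbacktracking_walk x d.+2.
Hypothesis perron : perron_branch e mu (x d.+1) (x d.+2).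

Let low i a := low_energy e mu (x i.+1) (x i) a.

Let r := #|branch e (x d.+1) (x d.+2)|.

Let mu_ge0 : 0 <= mu. Proof. exact: ltW. Qed.

Lemma walk_low_le1 i a : (i <= d)%N -> low i a -> a <= 1.
Proof.
move=> id; apply: (low_energy_le1 treeE min_mu (v := x d.+1) (v' := x d) (w := x d.+2)) => //.
- exact: (walk_back walkx).
- exact: walkx.1.
- exact: walkx.2.
- by apply: (walk_back walkx); lia.
- by apply: (walk_branch_sub walkx).
Qed.

Lemma walk_low_step i a : (i < d)%N -> a < 1 -> low i a -> low i.+1 (riccati_step mu a).
Proof.
move=> id; apply: low_energy_step => //.
- by apply: (walk_back walkx); lia.
- by apply: (walk_back walkx); lia.
- by apply: walkx.2; lia.
Qed.

Lemma walk_low_weaken i a b : b <= a -> low i a -> low i b.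
Proof. exact: low_energy_weaken. Qed.

(** The constant function 1 gives the value [mu] at the start. If [mu] were at least [1 / 2], one
    step would give [mu + 1 > 1]. *)
Lemma mu_lt_half : (0 < d)%N -> mu < 1 / 2.
Proof.
move=> d0; rewrite ltNge; apply/negP => mu_ge.
have low0 : low 0 mu.
  exists (fun=> 1); split=> //.
  rewrite (@energy_const _ _ _ _ treeE _ 1) //; last exact: (walk_back walkx).
  rewrite expr1n mulr1 mulNrn lerN2 -mulr_natr ler_peMr //.
  by rewrite ler1n card_branch_gt0.
have := walk_low_step d0 _ (walk_low_weaken mu_ge low0).
move=> /(_ ltac:(lra)) /(walk_low_le1 d0); rewrite /riccati_step.
have -> : 1 / 2 / (1 - 1 / 2) = 1 :> R by field.
by have := mu_gt0; lra.
Qed.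

(* Along the walk the Riccati recursion bounds the energies from above, exactly
   as it bounds them from below on paths. *)
Lemma walk_riccati_lt1 c a : low 0 a -> riccati mu c < a ->
  forall i, (i <= d)%N -> riccati mu (c + i) < 1.
Proof.
move=> low0 ca i id.
have [b lowb cb] : exists2 b, low i b & riccati mu (c + i) < b.
  elim: i id => [|i IH] id; first by exists a; rewrite ?addn0.
  have [b lowb cb] := IH (ltnW id).
  have b1 := walk_low_le1 (ltnW id) lowb.
  (* The value [b] may equal 1, where [walk_low_step] does not apply; the midpoint is smaller than 1
     and still exceeds the Riccati value. *)
  pose b' := (riccati mu (c + i) + b) / 2.
  have low' : low i b' by apply: walk_low_weaken lowb; rewrite /b'; lra.
  exists (riccati_step mu b'); first by apply: (walk_low_step id _ low'); rewrite /b'; lra.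
  by rewrite addnS /= -/(riccati mu (c + i)) riccati_step_lt // /b'; lra.
exact: lt_le_trans cb (walk_low_le1 id lowb).
Qed.

Lemma walk_low0 k : (0 < d)%N -> (k < #|branch e (x 1%N) (x 0%N)|)%N ->
  low 0 (mu + k%:R * (mu / (1 - mu))).
Proof.
move=> d0 lt_k; have mu1 : mu < 1 by have := mu_lt_half d0; lra.
have base := low_energy_base treeE (walk_back walkx (ltn0Sn _)) mu1.
apply: walk_low_weaken base; rewrite lerD2l ler_wpM2r //.
  by rewrite divr_ge0 //; lra.
by rewrite ler_nat; lia.
Qed.

Lemma perron_branch_card k : (forall j, (j <= k)%N -> riccati mu j < 1) -> (k < r)%N.
Proof.
move=> lt1; rewrite ltnNge; apply/negP => rk.
apply: (perron_branch_riccati treeE mu_ge0 _ perron) => [|j jr]; first exact: walkx.1.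
by apply: lt1; apply: leq_trans jr rk.
Qed.

Lemma perron_branch_card3 : (0 < d)%N -> (2 < #|branch e (x 1%N) (x 0%N)|)%N ->
  (d + 3 <= r)%N.
Proof.
move=> d0 /(walk_low0 d0) low0; have muh := mu_lt_half d0; have mu0 := mu_gt0.
have q0 : 0 < mu / (1 - mu) by rewrite divr_gt0 //; lra.
have k1 : riccati mu 1 = mu by rewrite /= /riccati_step mul0r addr0.
have lt2 : riccati mu 2 < mu + 2 * (mu / (1 - mu)) by rewrite riccatiS k1; lra.
rewrite addn3; apply: perron_branch_card => -[|[|j]] jd //; first by rewrite k1; lra.
by rewrite -add2n; apply: walk_riccati_lt1 low0 lt2 _ _; lia.
Qed.

Lemma perron_branch_card5 : (1 < d)%N -> (4 < #|branch e (x 1%N) (x 0%N)|)%N ->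
  (d + 5 <= r)%N.
Proof.
move=> d1 card5; have d0 : (0 < d)%N by lia.
have low0 := walk_low0 d0 card5; have muh := mu_lt_half d0; have mu0 := mu_gt0.
have k1 : riccati mu 1 = mu by rewrite /= /riccati_step mul0r addr0.
(* If [mu >= 1 / 17], the initial value is at least [1 / 17 + 4 / 16 > 77 / 250]; one step leads
   above [1 / 2], and the next one to [mu + 1 > 1]. *)
have mu17 : mu < 1 / 17.
  rewrite ltNge; apply/negP => mu_ge.
  have low0' : low 0 (77 / 250).
    apply: walk_low_weaken low0; suff : 1 / 16 <= mu / (1 - mu) by lra.
    by rewrite ler_pdivlMr; lra.
  have low1 : low 1 (1 / 2).
    apply: walk_low_weaken (walk_low_step d0 _ low0'); last by lra.
    rewrite /riccati_step; have -> : 77 / 250 / (1 - 77 / 250) = 77 / 173 :> R by field.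
    lra.
  have := walk_low_le1 d1 (walk_low_step d1 _ low1).
  have -> : riccati_step mu (1 / 2) = mu + 1 by rewrite /riccati_step; field.
  by move=> /(_ ltac:(lra)); lra.
(* Backward iterates of the initial value: [riccati_step] maps [x2] to [x3] and [x3] to
   [mu + 4 * (mu / (1 - mu))]. By monotonicity only [riccati mu 2 < x2] has to be checked by
   hand. *)
pose x2 := 3 * mu * (1 - mu) / (1 + 6 * mu - 3 * mu ^+ 2).
pose x3 := 4 * mu / (1 + 3 * mu).
have den2 : 0 < 1 + 6 * mu - 3 * mu ^+ 2 by nra.
have x2_lt1 : x2 < 1 by rewrite /x2 ltr_pdivrMr //; nra.
have x3_lt1 : x3 < 1 by rewrite /x3 ltr_pdivrMr //; lra.
have lt2 : riccati mu 2 < x2.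
  have -> : riccati mu 2 = (2 * mu - mu ^+ 2) / (1 - mu).
    by rewrite riccatiS k1; field; apply: lt0r_neq0; lra.
  rewrite /x2 ltr_pdivrMr; last lra.
  rewrite mulrAC ltr_pdivlMr // -subr_gt0.
  (* The factor [1 - 17 * mu] is the reason for the threshold [1 / 17]. *)
  have -> : 3 * mu * (1 - mu) * (1 - mu) - (2 * mu - mu ^+ 2) * (1 + 6 * mu - 3 * mu ^+ 2)
    = mu * (1 - 17 * mu + mu ^+ 2 * (15 - 3 * mu)) by ring.
  by rewrite mulr_gt0 // addr_gt0 ?mulr_gt0 ?exprn_gt0 //; lra.
have lt3 : riccati mu 3 < x3.
  have -> : x3 = riccati_step mu x2; last exact: riccati_step_lt.
  rewrite /x3 /x2 /riccati_step; field.
  by do ?[apply/andP; split]; apply: lt0r_neq0; nra.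
have lt4 : riccati mu 4 < mu + 4 * (mu / (1 - mu)).
  have -> : mu + 4 * (mu / (1 - mu)) = riccati_step mu x3; last exact: riccati_step_lt.
  rewrite /x3 /riccati_step; field.
  by do ?[apply/andP; split]; apply: lt0r_neq0; nra.
rewrite !addnS addn0.
apply: perron_branch_card => -[|[|[|[|j]]]] jd //; first by rewrite k1; lra.
- exact: lt_trans lt2 x2_lt1.
- exact: lt_trans lt3 x3_lt1.
by rewrite -add4n; apply: walk_riccati_lt1 low0 lt4 _ _; lia.
Qed.

End Blowup.

End Walk.

(** * Distances and centers *)

Section Distances.

Variables (V : finType) (e : rel V).

Lemma gdist_le x p : path e x p -> (gdist e x (last x p) <= size p)%N.
Proof.
move=> pp; rewrite leqNgt; apply/negP => lt_p.
have lt_V : (size p < #|V|)%N.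
  by apply: leq_trans lt_p _; rewrite -[X in (_ <= X)%N](size_iota 0) find_size.
have := before_find 0%N lt_p; rewrite nth_iota // add0n => /negbT/existsPn/(_ (in_tuple p)).
by rewrite /= pp eqxx.
Qed.

Lemma gdistP x y : connect e x y ->
  (gdist e x y < #|V|)%N /\
  exists p, [/\ path e x p, last x p = y & size p = gdist e x y].
Proof.
move=> /connectP[p0 pp0 ->]; case/shortenP: pp0 => p pp up _ {p0}.
have lt_V : (gdist e x (last x p) < #|V|)%N.
  apply: leq_ltn_trans (gdist_le pp) _.
  by rewrite -[(size p).+1]/(size (x :: p)) -(card_uniqP up) max_card.
split=> //; move: (lt_V); rewrite /gdist -[X in (_ < X)%N](size_iota 0) -has_find.
move=> /(nth_find 0%N); rewrite nth_iota // add0n.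
by case/existsP => q /andP[qp /eqP qE]; exists q; rewrite size_tuple.
Qed.

Lemma bigminn_le (I : eqType) (r : seq I) (P : pred I) (F : I -> nat) n i :
  i \in r -> P i -> (\big[minn/n]_(j <- r | P j) F j <= F i)%N.
Proof.
elim: r => // j r IH; rewrite inE big_cons => /orP[/eqP<- ->|ir Pi].
  exact: geq_minl.
by case: ifP => _; rewrite ?geq_min IH ?orbT.
Qed.

Lemma bigminn_attained (I : eqType) (r : seq I) (P : pred I) (F : I -> nat) n :
  \big[minn/n]_(j <- r | P j) F j = n \/
  exists2 i, P i & \big[minn/n]_(j <- r | P j) F j = F i.
Proof.
elim: r => [|i r IH]; first by left; rewrite big_nil.
rewrite big_cons; case: (boolP (P i)) => // Pi.
by rewrite /minn; case: ifP => _; [right; exists i|exact: IH].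
Qed.

Lemma set_dist_le (X Y : {set V}) x y : x \in X -> y \in Y ->
  (set_dist e X Y <= gdist e x y)%N.
Proof.
move=> xX yY.
have := bigminn_le (P := mem X) (fun x => \big[minn/#|V|]_(y in Y) gdist e x y) #|V|
  (mem_index_enum x) xX.
move/leq_trans; apply.
exact: (bigminn_le (P := mem Y) (gdist e x) #|V| (mem_index_enum y) yY).
Qed.

(** The minima could only fail to be attained by returning their default [#|V|], which exceeds every
    distance in a connected graph. *)
Lemma set_dist_attained (X Y : {set V}) : (forall x y, connect e x y) ->
  X != set0 -> Y != set0 ->
  exists x y, [/\ x \in X, y \in Y & set_dist e X Y = gdist e x y].
Proof.
move=> conn /set0Pn[x0 x0X] /set0Pn[y0 y0Y].
have lt_V : (set_dist e X Y < #|V|)%N.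
  by apply: leq_ltn_trans (set_dist_le x0X y0Y) (gdistP (conn x0 y0)).1.
have [dE|[x xX dE]] := bigminn_attained (index_enum V) (mem X)
    (fun x => \big[minn/#|V|]_(y in Y) gdist e x y) #|V|.
  by rewrite /set_dist dE ltnn in lt_V.
have [dE'|[y yY dE']] := bigminn_attained (index_enum V) (mem Y) (gdist e x) #|V|.
  by rewrite /set_dist dE dE' ltnn in lt_V.
by exists x, y; split=> //; rewrite /set_dist dE dE'.
Qed.

Lemma gdist_triangle x y z : (forall x y, connect e x y) ->
  (gdist e x z <= gdist e x y + gdist e y z)%N.
Proof.
move=> conn; have [_ [p [pp py sp]]] := gdistP (conn x y).
have [_ [q [qp qz sq]]] := gdistP (conn y z).
have := @gdist_le x (p ++ q); rewrite cat_path pp py qp => /(_ isT).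
by rewrite last_cat py qz size_cat sp sq.
Qed.

Lemma gdist_walk (v : nat -> V) d i j : (forall x y, connect e x y) ->
  (forall i, (i < d)%N -> e (v i) (v i.+1)) -> (i <= j <= d)%N ->
  (gdist e (v i) (v j) <= j - i)%N.
Proof.
move=> conn step; elim: j => [|j IH] /andP[ij jd].
  by move: ij; rewrite leqn0 => /eqP->; apply: (@gdist_le (v 0%N) [::]).
move: ij; rewrite leq_eqVlt => /orP[/eqP->|ij].
  by rewrite subnn; apply: (@gdist_le (v j.+1) [::]).
have := @gdist_le (v j) [:: v j.+1]; rewrite /= step // => /(_ isT).
have := gdist_triangle (v i) (v j) (v j.+1) conn.
by have := IH ltac:(lia); lia.
Qed.

(** A shortest walk between the two sets: meeting [X] after the start, meeting [Y] before the end,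
    or turning back would each permit a shorter one. *)
Lemma set_dist_walk (X Y : {set V}) : (forall x y, connect e x y) ->
  X != set0 -> Y != set0 -> exists v : nat -> V,
  [/\ v 0%N \in X, v (set_dist e X Y) \in Y,
      forall i, (i < set_dist e X Y)%N -> e (v i) (v i.+1),
      forall i, (0 < i <= set_dist e X Y)%N -> (v i \notin X) && (v i.-1 \notin Y)
    & forall i, (i.+1 < set_dist e X Y)%N -> v i != v i.+2].
Proof.
move=> conn X0 Y0; have [x [y [xX yY dE]]] := set_dist_attained conn X0 Y0.
have [_ [p [pp py]]] := gdistP (conn x y); rewrite -dE.
set d := set_dist e X Y => sp.
pose v i := nth x (x :: p) i.
have v0 : v 0%N \in X by [].
have vd : v d \in Y by rewrite /v -sp (nth_last x (x :: p)) /= py.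
have step i : (i < d)%N -> e (v i) (v i.+1).
  by move=> id; apply: (pathP x pp); rewrite sp.
have walk := gdist_walk conn step.
exists v; split=> // i id; first (apply/andP; split); apply/negP.
- move=> iX; have := set_dist_le iX vd; have := walk i d; rewrite -/d; lia.
- move=> iY; have := set_dist_le v0 iY; have := walk 0%N i.-1; rewrite -/d; lia.
- move=> /eqP vE; have := set_dist_le v0 vd; have := walk 0%N i.
  have := walk i.+2 d; have := gdist_triangle (v 0%N) (v i) (v d) conn.
  by rewrite -vE -/d; lia.
Qed.

Lemma connect_crossing (a : pred V) x y : connect e x y -> a x -> ~~ a y ->
  exists u v, [/\ e u v, a u & ~~ a v].
Proof.
move=> /connectP[p + ->]; elim: p x => [|z p IH] x /=; first by move=> _ ->.
case/andP=> exz pz ax; have [az|az] := boolP (a z); first exact: IH.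
by exists x, z.
Qed.

End Distances.

Lemma sqrt3_lt (R : realType) : Num.sqrt 3 < 26 / 15 :> R.
Proof.
have -> : 26 / 15 = Num.sqrt ((26 / 15) ^+ 2) :> R by rewrite sqrtr_sqr ger0_norm ?divr_ge0.
by rewrite ltr_sqrt //; lra.
Qed.

(** * Spectral center, characteristic set and the final count *)

Section Centers.

Variables (R : realType) (V : finType) (e : rel V).
Hypothesis treeE : is_tree e.
Hypothesis cardV : (1 < #|V|)%N.

Let symE : symmetric e. Proof. by case: treeE. Qed.
Let connE x y : connect e x y. Proof. by case: treeE. Qed.

Lemma perron_zero (s : R) k : (forall x, 0 <= k x) ->
  neighbor_sum e k =1 (fun x => s * k x) ->
  forall x y, k x = 0 -> k y = 0.
Proof.
move=> k0 ks x y kx; apply/eqP; apply: contraTT (connE x y) => ky.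
apply/negP => cxy.
have [u [v [euv /eqP ku /negP[]]]] :=
  connect_crossing (a := [pred z | k z == 0]) cxy (introT eqP kx) ky.
have /eqP := ks u; rewrite ku mulr0 /neighbor_sum psumr_eq0 //.
by move=> /allP/(_ v (mem_index_enum _)); rewrite euv.
Qed.

(** An eigenfunction of the largest eigenvalue has constant sign and no zeros, so [g1], being
    orthogonal to it, takes both signs. *)
Lemma lambda2_sign_change : exists f : V -> R,
  [/\ neighbor_sum e f =1 (fun x => lambda2 R e * f x),
      exists x, 0 < f x & exists x, f x < 0].
Proof.
have [l [g0 [g1 [g0l g1l [n0 n1] orth bound]]]] := lambda2_eigenfunctions R symE cardV.
have nz (g : V -> R) : \sum_x g x ^+ 2 = 1 -> exists x, g x != 0.
  move=> ng; apply/existsP; have [//|/existsPn gz] := boolP [exists x, g x != 0].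
  move: ng; rewrite big1 => [/eqP|x _]; first by rewrite eq_sym oner_eq0.
  by have /negPn/eqP -> := gz x; rewrite expr0n.
have [x0 gx0] := nz g0 n0; have [x1 gx1] := nz g1 n1.
(* Absolute values do not lower the Rayleigh quotient, so [|g0|] attains the maximum too. *)
have absE : neighbor_sum e (fun x => `|g0 x|) =1 (fun x => l * `|g0 x|).
  move=> x; apply: (@rayleigh_eigenfunction _ _ _ treeE [set: V]) => //.
  - by move=> h _; apply: bound.
  - by move=> y; rewrite inE.
  - under eq_bigr do rewrite real_normK ?num_real //.
    rewrite mulr_sumr; apply: ler_sum => y _.
    have -> : l * g0 y ^+ 2 = g0 y * neighbor_sum e g0 y by rewrite g0l; ring.
    apply: le_trans (ler_norm _) _; rewrite normrM ler_wpM2l //.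
    exact: ler_norm_sum.
have g0_neq0 x : g0 x != 0.
  apply/eqP => gx; have := perron_zero (fun x => normr_ge0 (g0 x)) absE x0 (x := x).
  by rewrite gx normr0 => /(_ erefl)/eqP; rewrite normr_eq0 (negPf gx0).
(* The function [k] is a nonnegative eigenfunction, so it vanishes everywhere or nowhere;
   accordingly [g0] is positive or negative throughout. *)
have [c [c0 cpos]] : exists c : R, c != 0 /\ forall x, 0 < c * g0 x.
  pose k x := `|g0 x| - g0 x.
  have k0 x : 0 <= k x by rewrite subr_ge0 ler_norm.
  have kl : neighbor_sum e k =1 (fun x => l * k x).
    by move=> x; rewrite /neighbor_sum sumrB -/(neighbor_sum e _ x) absE
      -/(neighbor_sum e g0 x) g0l mulrBr.
  have [kx|kx] := eqVneq (k x0) 0.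
    exists 1; split=> [|x]; first exact: oner_neq0.
    have := perron_zero k0 kl x kx; move/eqP; rewrite subr_eq0 mul1r => /eqP <-.
    by rewrite normr_gt0.
  exists (-1); split=> [|x]; first by rewrite oppr_eq0 oner_neq0.
  rewrite mulN1r oppr_gt0 lt_neqAle g0_neq0 leNgt /=; apply/negP => gx.
  have := perron_zero k0 kl x0 (x := x); rewrite /k gtr0_norm // subrr => /(_ erefl)/eqP.
  by rewrite (negPf kx).
have no_sign (g : V -> R) : \sum_x g0 x * g x = 0 -> (exists x, g x != 0) ->
    exists x, 0 < g x.
  move=> og [x gx]; apply/existsP; apply: contraNT gx => /existsPn gle.
  have : \sum_x - (c * g0 x * g x) = 0.
    rewrite sumrN (eq_bigr (fun x => c * (g0 x * g x))) => [|y _]; last by rewrite mulrA.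
    by rewrite -mulr_sumr og mulr0 oppr0.
  have ge0 y : 0 <= - (c * g0 y * g y).
    by rewrite oppr_ge0 mulr_ge0_le0 ?(ltW (cpos y)) // leNgt gle.
  move/eqP; rewrite psumr_eq0 // => /allP/(_ x (mem_index_enum _)) /=.
  by rewrite oppr_eq0 mulf_eq0 gt_eqF.
exists g1; split=> //; first by apply: no_sign => //; exists x1.
have [||y gy] := no_sign (fun x => - g1 x).
- by rewrite (eq_bigr (fun x => - (g0 x * g1 x))) ?sumrN ?orth ?oppr0 // => x _; rewrite mulrN.
- by exists x1; rewrite oppr_eq0.
by exists y; rewrite -oppr_gt0.
Qed.

Lemma spectral_center_bounded (S : {set V}) v0 v1 : is_spectral_center R e S ->
  v0 \in S -> v1 \notin S -> e v0 v1 ->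
  rayleigh_bounded e (branch e v0 v1) (lambda2 R e).
Proof.
move=> /minsetp/andP[/andP[_ /forall_inP subS] /forall_inP rad] v0S v1S e01 h hout.
pose A := component_in e (~: S) v1.
(* As [S] is connected and contains [v0], it could reach the branch only through [v1], which lies
   outside [S]. So the branch lies in one component of the complement of [S]. *)
have disj x : x \in branch e v0 v1 -> x \notin S.
  move=> xB; apply/negP => xS; have /forall_inP/(_ x xS) := subS v0 v0S.
  have v0B := branch_notin e (edge_neq treeE e01).
  move=> /(connect_crossing (a := [predC branch e v0 v1])) /=.
  rewrite v0B xB => /(_ isT isT)[a [b [/and3P[aS bS eab] aB /negPn bB]]].
  have eba : e b a by rewrite symE.
  have [bv1 _] := branch_boundary treeE e01 bB eba aB.
  by rewrite -bv1 bS in v1S.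
have subA x : x \in branch e v0 v1 -> x \in A.
  suff sub : {subset branch e v0 v1 <= [predI A & branch e v0 v1]}.
    by move=> /sub /andP[].
  apply: sub_branch => [|a b /andP[/= aA aB] eab av0 bv0].
    by rewrite inE /= branch_self !inE v1S connect0.
  have bB := branch_step aB eab av0 bv0.
  rewrite inE /= bB andbT; move: aA; rewrite !inE => /andP[aS ca].
  rewrite disj //=; apply: connect_trans ca (connect1 _).
  by rewrite /restrict_rel /= !in_setC aS disj.
have sumA (F : V -> R) : (forall x, h x = 0 -> F x = 0) -> \sum_x F x = \sum_(x in A) F x.
  move=> F0; rewrite (bigID (mem A)) /= [X in _ + X]big1 ?addr0 // => x xA.
  by apply/F0/hout; apply: contra xA; apply: subA.
have v1A : v1 \in ~: S by rewrite inE.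
have := rad v1 v1A; have := induced_rayleigh A h symE.
set rho := spectral_radius _ => le1 le2.
apply: (@le_trans _ _ (\sum_(x in A) \sum_(y in A | e x y) h x * h y)).
  rewrite le_eqVlt; apply/orP; left; apply/eqP.
  rewrite /adj_form sumA => [|x ->]; last by rewrite mul0r.
  apply: eq_bigr => x _; rewrite mulr_sumr (bigID (mem A)) /= [X in _ + X]big1 ?addr0.
    by apply: eq_bigl => y; rewrite andbC.
  by move=> y /andP[_ yA]; rewrite (hout y) ?mulr0 //; apply: contra yA; apply: subA.
apply: le_trans le1 _; rewrite [X in _ <= _ * X]sumA => [|x ->]; last by rewrite expr0n.
by rewrite ler_wpM2r // sumr_ge0 // => x _; apply: sqr_ge0.
Qed.

Lemma sum_laplace (f : V -> R) : \sum_x laplace e f x = 0.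
Proof.
have : \sum_x laplace e f x = - \sum_x laplace e f x.
  rewrite [LHS](exchange_big_dep xpredT) //= -sumrN; apply: eq_bigr => x _.
  rewrite -sumrN; apply: eq_big => [y|y _]; first by rewrite /= symE.
  by rewrite opprB.
by move: (\sum_x _) => t; lra.
Qed.

Lemma zero_sum_signs (P : pred V) (g : V -> R) : \sum_(x | P x) g x = 0 ->
  (exists2 x, P x & g x != 0) ->
  (exists2 x, P x & 0 < g x) /\ (exists2 x, P x & g x < 0).
Proof.
have pos (h : V -> R) : \sum_(x | P x) h x = 0 -> (exists2 x, P x & h x != 0) ->
    exists2 x, P x & 0 < h x.
  move=> h0 [x Px hx]; apply/exists_inP; apply: contraNT hx => /exists_inPn hle.
  have : \sum_(y | P y) - h y = 0 by rewrite sumrN h0 oppr0.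
  move/eqP; rewrite psumr_eq0 => [/allP/(_ x (mem_index_enum _))|y Py].
    by rewrite Px oppr_eq0.
  by rewrite oppr_ge0 leNgt hle.
move=> g0 [x Px gx]; split; first by apply: pos => //; exists x.
have [||y Py] := pos (fun x => - g x); first by rewrite sumrN g0 oppr0.
  by exists x; rewrite ?oppr_eq0.
by rewrite oppr_gt0; exists y.
Qed.

Section Fiedler.

Variable F : 'rV[R]_#|V|.
Hypothesis fiedlerF : fiedler e F.
Hypothesis mu_gt0 : 0 < mu2 R e.

Let f := entry F.

Let fmu : laplace e f =1 (fun x => mu2 R e * f x).
Proof. by have [] := fiedler_eigenfunction symE fiedlerF. Qed.

Lemma fiedler_signs : (exists x, 0 < f x) /\ (exists x, f x < 0).
Proof.
have [_ [x fx]] := fiedler_eigenfunction symE fiedlerF.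
have f0 : \sum_x f x = 0.
  have := sum_laplace f; rewrite (eq_bigr _ (fun x _ => fmu x)) -mulr_sumr => /eqP.
  by rewrite mulf_eq0 gt_eqF //= => /eqP.
have [] := zero_sum_signs f0; first by exists x.
by move=> [y _ fy] [z _ fz]; split; [exists y|exists z].
Qed.

Lemma laplace_opp : laplace e (fun x => - f x) =1 (fun x => mu2 R e * - f x).
Proof.
by move=> x; rewrite mulrN -fmu /laplace -sumrN; apply: eq_bigr => y _; ring.
Qed.

Lemma characteristic_set_neq0 : characteristic_set_of e F != set0.
Proof.
have [[p fp] [q fq]] := fiedler_signs; rewrite /characteristic_set_of.
case: ifP => [/existsP[z fz]|/negbT/existsPn nz].
  have [|a [b [eab fa fb]]] := connect_crossing (a := [pred x | entry F x == 0]) (connE z p) fz.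
    by rewrite /= gt_eqF.
  rewrite /= in fa fb; apply/set0Pn; exists a.
  by rewrite inE fa; apply/existsP; exists b; rewrite eab.
have [||a [b [eab fa fb]]] := connect_crossing (a := [pred x | 0 < entry F x]) (connE p q) => //.
  by rewrite /= -leNgt ltW.
rewrite /= in fa fb; apply/set0Pn; exists a; apply/bigcupP.
exists (a, b); last by rewrite !inE eqxx.
by rewrite /= eab fa lt_neqAle nz /= leNgt.
Qed.

(** If [f v = 0], the neighbour values sum to zero, so there are neighbours of both signs and one of
    them differs from [u]. For a characteristic edge the other endpoint serves. Negative values are
    handled through [- f]. *)
Lemma characteristic_perron_branch v u :
  v \in characteristic_set_of e F -> u \notin characteristic_set_of e F ->
  exists w, [/\ e v w, w != u & perron_branch e (mu2 R e) v w].
Proof.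
have pos w : e v w -> f v <= 0 -> 0 < f w -> perron_branch e (mu2 R e) v w.
  by move=> evw; apply: perron_branch_positive_part.
have neg w : e v w -> 0 <= f v -> f w < 0 -> perron_branch e (mu2 R e) v w.
  move=> evw fv fw; apply: (perron_branch_positive_part treeE evw laplace_opp).
    by rewrite oppr_le0.
  by rewrite oppr_gt0.
rewrite /characteristic_set_of; case: ifP => [_|_].
  rewrite !inE => /andP[/eqP fv /existsP[w0 /andP[evw0 fw0]]] _.
  have s0 : \sum_(y | e v y) f y = 0.
    have := fmu v; rewrite /laplace sumrB -/f [f v]fv mulr0 sumr_const mul0rn sub0r.
    by move/eqP; rewrite oppr_eq0 => /eqP.
  have [|[a eva fa] [b evb fb]] := zero_sum_signs s0; first by exists w0.
  have [au|au] := eqVneq a u; last by exists a; split=> //; apply: pos; rewrite // [f v]fv.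
  exists b; split=> //; last by apply: neg; rewrite // [f v]fv.
  by apply: contraTneq fb => ->; rewrite -au -leNgt ltW.
move=> /bigcupP[[a b] /= /and3P[eab fa fb]]; rewrite !inE => vab uC.
have inC x : x \in [set a; b] -> x != u.
  by move=> xab; apply: contraNneq uC => <-; apply/bigcupP; exists (a, b); rewrite ?eab ?fa ?fb.
case/orP: vab => /eqP vE; rewrite vE in pos neg *.
  by exists b; split; [|by rewrite inC // !inE eqxx orbT|apply: neg => //; apply: ltW].
have eba : e b a by rewrite symE.
by exists a; split; [|by rewrite inC // !inE eqxx|apply: pos => //; apply: ltW].
Qed.

End Fiedler.

Lemma extend_walk (v : nat -> V) d w : (0 < d)%N ->
  (forall i, (i < d)%N -> e (v i) (v i.+1)) ->
  (forall i, (i.+1 < d)%N -> v i != v i.+2) -> e (v d) w -> w != v d.-1 ->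
  exists y, [/\ nonbacktracking_walk e y d.+1, forall i, (i <= d)%N -> y i = v i
    & y d.+1 = w].
Proof.
move=> d0 step nback evw wv; pose y i := if (i <= d)%N then v i else w.
have yE i : (i <= d)%N -> y i = v i by rewrite /y => ->.
have yd1 : y d.+1 = w by rewrite /y ltnn.
exists y; split=> //; split=> i; rewrite ltnS leq_eqVlt => /orP[/eqP id|id].
- by rewrite id yd1 yE.
- by rewrite !yE //; [apply: step|apply: ltnW].
- have -> : i = d.-1 by rewrite -id.
  by rewrite prednK // yd1 yE ?leq_pred // eq_sym.
- by rewrite !yE //; [apply: nback|apply: ltnW (ltnW id)].
Qed.

(** If all other branches at [v0] had at most [k + 1] vertices, their Rayleigh quotients would be at
    most [s < l], contradicting [heavy_branch]. *)
Lemma heavy_branch_card f v0 v1 s k l : e v0 v1 ->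
  neighbor_sum e f =1 (fun x => l * f x) ->
  (exists x, 0 < f x) -> (exists x, f x < 0) ->
  rayleigh_bounded e (branch e v0 v1) l ->
  0 < s -> s ^+ 2 = k%:R :> R -> s < l ->
  exists u, [/\ e v0 u, u != v1 & (k.+1 < #|branch e v0 u|)%N].
Proof.
move=> e01 fl fpos fneg bounded s0 sk sl.
have [/existsP[u /and3P[*]]|/existsPn none] := boolP [exists u,
  [&& e v0 u, u != v1 & (k.+1 < #|branch e v0 u|)%N]]; first by exists u.
case: (heavy_branch treeE e01 fl fpos fneg bounded sl) => u e0u uv1.
apply: (small_branch_bounded treeE s0 sk e0u).
by have := none u; rewrite e0u uv1 /= -leqNgt.
Qed.

Lemma order_ge_of_walk (mu l : R) (y : nat -> V) d :
  0 < mu ->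
  (forall g : V -> R, \sum_x g x = 0 -> 2 * mu * \sum_x g x ^+ 2 <= dirichlet e g) ->
  (1 < d)%N -> nonbacktracking_walk e y d.+1 ->
  perron_branch e mu (y d) (y d.+1) ->
  (forall s k, 0 < s -> s ^+ 2 = k%:R -> s < l ->
    exists u, [/\ e (y 0%N) u, u != y 1%N & (k.+1 < #|branch e (y 0%N) u|)%N]) ->
  rayleigh_bounded e (branch e (y 0%N) (y 1%N)) l ->
  (2 * d + 11 <= #|V|)%N.
Proof.
move=> mu_gt0 min_mu d1 walky perron heavy bounded.
have d0 : (0 < d)%N := ltnW d1.
have e01 : e (y 0%N) (y 1%N) by apply: walky.1.
have e12 : e (y 1%N) (y 2) by apply: walky.1; rewrite ltnS ltnW.
have y20 : y 2 != y 0%N by rewrite eq_sym; apply: walky.2; rewrite ltnS ltnW.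
have := rayleigh_bounded_ge treeE e01 e12 y20 bounded.
set m := #|branch e (y 1%N) (y 2)| => lower.
set r := #|branch e (y d) (y d.+1)|.
pose x u i := if i is i'.+1 then y i' else u.
have walkx u : e (y 0%N) u -> u != y 1%N -> nonbacktracking_walk e (x u) d.+2.
  move=> e0u uv1; split=> [[|i] id|[|i] id] //=; first by rewrite symE.
    exact: walky.1.
  exact: walky.2.
have card_r : (d - 1 + r <= m)%N by apply: (walk_card_forward treeE walky).
have r0 : (0 < r)%N by apply: card_branch_gt0.
have m2 : (2 <= m)%N by apply: leq_trans card_r; rewrite (leq_add (m1 := 1)) // subn_gt0.
have [u [e0u uv1 card_u]] : exists u,
    [/\ e (y 0%N) u, u != y 1%N & (2 < #|branch e (y 0%N) u|)%N].
  apply: (heavy 1) => //; first by rewrite expr1n.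
  have : 2 <= m%:R :> R by rewrite ler_nat.
  rewrite ltNge => m2R; apply/negP => /(ler_wpM2r (_ : 0 <= m%:R + 9 / 25 :> R)).
  by move=> /(_ ltac:(lra)); lra.
have r3 : (d + 3 <= r)%N.
  by apply: (perron_branch_card3 treeE mu_gt0 min_mu (walkx u e0u uv1) perron).
(* From [d - 1 + r <= m], [d + 3 <= r] and [2 <= d]. *)
have m6 : (6 <= m)%N by move: card_r r3 d1; clearbody m r; clear; lia.
have [u' [e0u' u'v1 card_u']] : exists u,
    [/\ e (y 0%N) u, u != y 1%N & (4 < #|branch e (y 0%N) u|)%N].
  apply: (heavy (Num.sqrt 3)); [by rewrite sqrtr_gt0|by rewrite sqr_sqrtr|].
  have : 6 <= m%:R :> R by rewrite ler_nat.
  rewrite ltNge => m6R; apply/negP => ls.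
  have := ler_wpM2r (_ : 0 <= m%:R + 9 / 25 :> R) (le_trans ls (ltW (sqrt3_lt R))).
  by move=> /(_ ltac:(lra)); lra.
have r5 : (d + 5 <= r)%N.
  by apply: (perron_branch_card5 treeE mu_gt0 min_mu (walkx u' e0u' u'v1) perron).
(* Cut at the last edge of the walk: the side of [y d] has at least [1 + r] vertices, the other side
   at least [d] plus the size of the branch at [u']. With [d + 5 <= r] and at least 5 vertices at
   [u'] this sums to [2 * d + 11]. *)
have := walk_card_back treeE (walkx u' e0u' u'v1) (leqnSn d.+1).
have := walk_card_forward treeE walky (leq_pred d) (ltnSn d).
have dE := prednK d0.
have := card_branch_opposite treeE (walky.1 d.-1 (leqW (eq_leq dE))).
rewrite dE /= -/r; have -> : x u' d = y d.-1 by rewrite -[in LHS]dE.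
move: d1 r5 card_u'; clearbody r; clear; lia.
Qed.

End Centers.

Local Close Scope ring_scope.

Theorem theorem1p2 (R : realType) (V : finType) (e : rel V)
    (htree : is_tree e) (hV : 1 < #|V|)
    (S C : {set V})
    (hS : is_spectral_center R e S) (hC : is_characteristic_set R e C) :
  2 <= set_dist e S C -> 2 * set_dist e S C + 11 <= #|V|.
Proof.
have [symE _ connE _] := htree.
have [F fiedF CE] := hC.
have [mu_gt0 min_mu] := mu2_spec R symE hV connE.
have S0 : S != set0 by case/minsetp/andP: hS => /andP[].
have C0 : C != set0 by rewrite CE (characteristic_set_neq0 htree).
have [v [v0S vdC step outC nback]] := set_dist_walk connE S0 C0.
set d := set_dist e S C in v0S vdC step outC nback * => d1.
have d0 : 0 < d := ltnW d1.
have /andP[_ vd1C] : (v d \notin S) && (v d.-1 \notin C) by apply: outC; rewrite d0 /=.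
have /andP[v1S _] : (v 1 \notin S) && (v 0 \notin C) by apply: outC; rewrite d0.
rewrite CE in vdC vd1C.
have [w [evw wv perron]] := characteristic_perron_branch htree fiedF vdC vd1C.
have [y [walky yE yd1]] := extend_walk d0 step nback evw wv.
rewrite -(yE d) // -yd1 in perron.
have e01 : e (v 0) (v 1) := step 0 d0.
have bounded := spectral_center_bounded htree hS v0S v1S e01.
have [f [fl fpos fneg]] := lambda2_sign_change R htree hV.
apply: (order_ge_of_walk htree mu_gt0 min_mu d1 walky perron (l := lambda2 R e)).
  by move=> s k; rewrite !yE //; apply: heavy_branch_card fl fpos fneg bounded.
by rewrite !yE.
Qed.
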